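(* There is an absolute constant $\gamma_0>0$ such that $\mathcal{M}_8(\Sigma)\ge\gamma_0$ for every closed, compact and connected Lipschitz surface $\Sigma\subset\mathbb{R}^3$.
   Context: A closed, compact and connected Lipschitz surface is a compact connected set $\Sigma\subset\mathbb{R}^3$ with $\Sigma=\partial U$ for some bounded domain $U\subset\mathbb{R}^3$, such that near each of its points $\Sigma$ is, after a rigid motion, the graph of a Lipschitz function of two variables. For a tetrahedron $T=(x_0,x_1,x_2,x_3)\in(\mathbb{R}^3)^4$ put $\mathcal{K}(T)=\dfrac{V(T)}{A(T)(\operatorname{diam}T)^2}$ if the four vertices are not co-planar, and $\mathcal{K}(T)=0$ otherwise, where $V(T)$ is the volume of $T$ and $A(T)$ is the sum of the areas of its four triangular faces. The integral Menger curvature is $\mathcal{M}_p(\Sigma)=\int_{\Sigma}\int_\Sigma\int_\Sigma\int_\Sigma\mathcal{K}^p(x_0,x_1,x_2,x_3)\,d\mathcal{H}^2(x_0)\,d\mathcal{H}^2(x_1)\,d\mathcal{H}^2(x_2)\,d\mathcal{H}^2(x_3)$, with $\mathcal{H}^2$ the two-dimensional Hausdorff measure; here $p=8$. *)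

(* Defs.v *)
From HB Require Import structures.
From mathcomp Require Import all_boot all_order all_algebra.
From mathcomp Require Import all_classical all_reals all_analysis.

Set Implicit Arguments.
Unset Strict Implicit.
Unset Printing Implicit Defensive.

Import Order.TTheory GRing.Theory Num.Theory.
Import numFieldNormedType.Exports.

Local Open Scope classical_set_scope.
Local Open Scope ring_scope.

(* The library norm on ['rV[R]_n] is the sup norm: it gives the usual topology
   and the usual Lipschitz functions, but all metric quantities below are taken
   with respect to the Euclidean norm [enorm]. *)

Section Euclidean.
Context {R : realType} {n : nat}.
Implicit Types (u v : 'rV[R]_n) (A : set 'rV[R]_n).

Definition dot u v : R := \sum_i u 0 i * v 0 i.

Definition enorm u : R := Num.sqrt (dot u u).

(* Adjoining 0 gives the empty set diameter 0 instead of -oo. *)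
Definition ediam A : \bar R :=
  ereal_sup (0%E |` [set (enorm (x - y))%:E | x in A & y in A]).

End Euclidean.

(* The weight of a covering set is the area of the disc of the same diameter,
   so that the measure agrees with area on planes. *)

Section Hausdorff2.
Context {R : realType}.
Implicit Types (A : set 'rV[R]_3) (F : (set 'rV[R]_3)^nat) (delta : R).

Definition fine_cover delta A F : Prop :=
  (forall k, (ediam (F k) <= delta%:E)%E) /\ A `<=` \bigcup_k F k.

Definition hausdorff2_content delta A : \bar R :=
  ereal_inf [set (\sum_(0 <= k <oo) (pi / 4)%:E * ediam (F k) ^+ 2)%E
            | F in fine_cover delta A].

Definition hausdorff2 A : \bar R :=
  ereal_sup [set hausdorff2_content delta A | delta in [set d : R | 0 < d]].

Lemma ediam_ge0 A : (0 <= ediam A)%E.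
Proof. by apply: ereal_sup_ubound; left. Qed.

Lemma ediam0 : ediam (set0 : set 'rV[R]_3) = 0%E.
Proof.
apply/eqP; rewrite eq_le ediam_ge0 andbT; apply: ge_ereal_sup => r [->//|].
by case=> x [].
Qed.

Lemma hausdorff2_weight_ge0 A : (0 <= (pi / 4)%:E * ediam A ^+ 2)%E.
Proof.
apply: mule_ge0; last by apply: expe_ge0; exact: ediam_ge0.
by rewrite lee_fin divr_ge0// pi_ge0.
Qed.

(* The content is the outer measure [mu_ext] generated by the following gauge,
   every set being taken as measurable. *)
Definition hausdorff2_gauge delta
    (A : set (g_sigma_algebraType [set: set 'rV[R]_3])) : \bar R :=
  if (ediam A <= delta%:E)%E then ((pi / 4)%:E * ediam A ^+ 2)%E else +oo%E.

Lemma hausdorff2_gauge_ge0 delta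
    (A : set (g_sigma_algebraType [set: set 'rV[R]_3])) :
  (0 <= hausdorff2_gauge delta A)%E.
Proof.
by rewrite /hausdorff2_gauge; case: ifP => // _; exact: hausdorff2_weight_ge0.
Qed.

Lemma hausdorff2_gauge0 delta : 0 < delta -> hausdorff2_gauge delta set0 = 0%E.
Proof.
by move=> d0; rewrite /hausdorff2_gauge ediam0 lee_fin (ltW d0) expe2 !mule0.
Qed.

Lemma hausdorff2_contentE delta A :
  hausdorff2_content delta A = mu_ext (hausdorff2_gauge delta) A.
Proof.
apply/eqP; rewrite eq_le; apply/andP; split.
- apply: le_ereal_inf_tmp => _ [F [mF AF] <-].
  have [Fd|] := pselect (forall k, (ediam (F k) <= delta%:E)%E).
    apply: ereal_inf_lbound; exists F; first by split.
    by apply: eq_eseriesr => k _; rewrite /hausdorff2_gauge Fd.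
  move=> /existsNP[k /negP Fk].
  rewrite (@eseries_pinfty _ _ xpredT k) ?leey//.
    by move=> i _; rewrite -ltNye (lt_le_trans _ (hausdorff2_gauge_ge0 _ _)).
  by rewrite /hausdorff2_gauge (negbTE Fk).
- apply: le_ereal_inf_tmp => _ [F [Fd AF] <-].
  apply: ereal_inf_lbound; exists F.
    by split=> // i; exact: sub_sigma_algebra.
  by apply: eq_eseriesr => k _; rewrite /hausdorff2_gauge Fd.
Qed.

Lemma hausdorff2_set0 : hausdorff2 set0 = 0%E.
Proof.
have content0 d : 0 < d -> hausdorff2_content d set0 = 0%E.
  move=> d0; rewrite hausdorff2_contentE.
  exact: mu_ext0 (hausdorff2_gauge0 d0) (@hausdorff2_gauge_ge0 d).
rewrite /hausdorff2; apply/eqP; rewrite eq_le; apply/andP; split.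
  by apply: ge_ereal_sup => _ [d /= d0 <-]; rewrite content0.
by apply: ereal_sup_ubound; exists 1 => //=; rewrite content0.
Qed.

Lemma hausdorff2_ge0 A : (0 <= hausdorff2 A)%E.
Proof.
apply: (@le_trans _ _ (hausdorff2_content 1 A)).
  by rewrite hausdorff2_contentE; exact: (mu_ext_ge0 (@hausdorff2_gauge_ge0 1)).
by apply: ereal_sup_ubound; exists 1 => //=.
Qed.

Lemma le_hausdorff2 : {homo hausdorff2 : A B / A `<=` B >-> (A <= B)%E}.
Proof.
move=> A B AB; apply: ge_ereal_sup => _ [d /= d0 <-].
apply: (@le_trans _ _ (hausdorff2_content d B)).
  by rewrite !hausdorff2_contentE; exact: le_mu_ext.
by apply: ereal_sup_ubound; exists d.
Qed.

Lemma hausdorff2_sigma_subadditive : sigma_subadditive hausdorff2.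
Proof.
move=> F; apply: ge_ereal_sup => _ [d /= d0 <-]; rewrite hausdorff2_contentE.
have /le_trans := @mu_ext_sigma_subadditive _ _ _ _ (@hausdorff2_gauge_ge0 d) F; apply.
apply: lee_nneseries => i _.
  by move=> _; exact: (mu_ext_ge0 (@hausdorff2_gauge_ge0 d)).
by rewrite -hausdorff2_contentE; apply: ereal_sup_ubound; exists d.
Qed.

HB.instance Definition _ := isOuterMeasure.Build R 'rV[R]_3 hausdorff2
  hausdorff2_set0 hausdorff2_ge0 le_hausdorff2 hausdorff2_sigma_subadditive.

Definition hausdorff2_outer : {outer_measure set 'rV[R]_3 -> \bar R} :=
  hausdorff2.

(* The two-dimensional Hausdorff measure, on the sigma-algebra of its
   Caratheodory measurable sets. *)
Definition H2 : {measure set (caratheodory_type hausdorff2_outer) -> \bar R} :=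
  hausdorff2_outer.

End Hausdorff2.

Section Tetrahedron.
Context {R : realType}.
Implicit Types x y z : 'rV[R]_3.

Definition coplanar x0 x1 x2 x3 : Prop :=
  exists (nu : 'rV[R]_3) (c : R), nu != 0 /\
    [/\ dot nu x0 = c, dot nu x1 = c, dot nu x2 = c & dot nu x3 = c].

(* Half the area of the parallelogram spanned by [y - x] and [z - x], the
   latter being the square root of their Gram determinant. *)
Definition triangle_area x y z : R :=
  Num.sqrt (dot (y - x) (y - x) * dot (z - x) (z - x)
            - dot (y - x) (z - x) ^+ 2) / 2.

Definition tetra_area x0 x1 x2 x3 : R :=
  triangle_area x1 x2 x3 + triangle_area x0 x2 x3
  + triangle_area x0 x1 x3 + triangle_area x0 x1 x2.

Definition tetra_volume x0 x1 x2 x3 : R :=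
  `|\det (\matrix_(i < 3) [:: x1 - x0; x2 - x0; x3 - x0]`_i)| / 6.

(* The diameter of a tetrahedron is that of its set of vertices. *)
Definition tetra_diam x0 x1 x2 x3 : R := fine (ediam [set x0; x1; x2; x3]).

Definition tetra_curvature x0 x1 x2 x3 : R :=
  if `[< coplanar x0 x1 x2 x3 >] then 0
  else tetra_volume x0 x1 x2 x3 /
       (tetra_area x0 x1 x2 x3 * tetra_diam x0 x1 x2 x3 ^+ 2).

Definition integral_menger (p : R) (S : set 'rV[R]_3) : \bar R :=
  (\int[H2]_(x3 in S) \int[H2]_(x2 in S) \int[H2]_(x1 in S) \int[H2]_(x0 in S)
     (tetra_curvature x0 x1 x2 x3 `^ p)%:E)%E.

End Tetrahedron.

Section LipschitzSurface.
Context {R : realType}.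
Implicit Types (S U W : set 'rV[R]_3).

Definition boundary U : set 'rV[R]_3 := closure U `\` U°.

Definition bounded_domain U : Prop :=
  [/\ U !=set0, open U, connected U & bounded_set U].

(* Orientation reversing isometries are allowed, which does not change the
   notion of Lipschitz surface: exchanging the first two coordinates maps
   graphs to graphs. *)
Definition rigid_motion (phi : 'rV[R]_3 -> 'rV[R]_3) : Prop :=
  exists (Q : 'M[R]_3) (b : 'rV[R]_3),
    Q *m Q^T = 1%:M /\ phi = (fun x => x *m Q + b).

Definition graph2 (f : 'rV[R]_2 -> R^o) : set 'rV[R]_3 :=
  [set (row_mx u (f u)%:M : 'rV[R]_(2 + 1)) | u in [set: 'rV[R]_2]].

Definition locally_lipschitz_graph S : Prop :=
  forall x, S x -> exists (W : set 'rV[R]_3) phi (f : 'rV[R]_2 -> R^o),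
    [/\ open_nbhs x W, rigid_motion phi, [lipschitz f u | u in [set: 'rV[R]_2]]
      & S `&` W = phi @^-1` graph2 f `&` W].

Definition lipschitz_surface S : Prop :=
  [/\ compact S, connected S,
      (exists2 U, bounded_domain U & S = boundary U)
    & locally_lipschitz_graph S].

End LipschitzSurface.

(* Main.v *)
Require Import Defs.
From mathcomp Require Import all_boot all_order all_algebra.
From mathcomp Require Import ring lra.
From mathcomp Require Import all_classical all_reals all_analysis.
From mathcomp Require Import measurable_realfun.

Set Implicit Arguments.
Unset Strict Implicit.
Unset Printing Implicit Defensive.

Import Order.TTheory GRing.Theory Num.Theory.
Import numFieldNormedType.Exports.

Local Open Scope classical_set_scope.
Local Open Scope ring_scope.

(** The exponent 8 makes the energy invariant under scaling, so one fat tetrahedron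
 with vertices on the surface gives an absolute amount of energy, as soon as each of
 its vertices sees on the surface, at the scale of the tetrahedron, a fixed proportion
 of the area of a disc: moving the vertices slightly keeps the tetrahedron fat
 ([fat_tetra_curvature], [menger_fat_family]). The task is to find a scale at which
 this happens. Let [S] be the boundary of [U].

 If there are fat tetrahedra of arbitrarily small sizes, the energy is infinite. Indeed
 a compact Lipschitz surface has a positive lower density, which depends on the
 surface ([surface_density]), so infinitely many sizes contribute the same amount, and
 the contributions add up because the integrand grows geometrically with the
 inverse size ([menger_fat_at_all_scales]).

 Otherwise there is a smallest size [d] of fat tetrahedra, up to a factor two. In a ball
 of radius less than [d] centred on [S] there is no fat tetrahedron of that size, so
 [S] lies there in a thin slab ([no_fat_flat]). If moreover the two caps outside of the
 slab are on different sides of [S], one in [U] and the other one outside of its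
 closure, then every segment across the slab meets [S], so that [S] projects onto a
 disc and its area is bounded below by an absolute constant ([separated_density]). This
 separation property, once true in one ball, propagates as long as [S] is flat: to
 comparable radii and to neighbouring centres ([separated_transfer]), hence to larger
 radii and, [S] being connected, to all of [S]. A ball with the property and of radius
 as small as desired exists by [separated_spot]: a Lipschitz function is almost affine
 near the midpoint of a short segment along which its local Lipschitz constant is
 almost attained, and this with an error independent of the Lipschitz constant. So at
 the scale just below [d] the surface has an absolute lower density everywhere, and in
 particular at the vertices of a fat tetrahedron of size [d] ([menger_lower_bound]). A
 smallest size exists because separation cannot hold at radii larger than [U]
 ([separated_bounded]).

 Areas are bounded below by projection to a plane ([hausdorff2_projection]). To
 integrate over parts of [S], closed sets are shown to be measurable for the Hausdorff
 measure ([closed_caratheodory]). *)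

(** * Euclidean vectors *)

Section Euclid.
Context {R : realType} {n : nat}.
Implicit Types (u v w : 'rV[R]_n) (a b : R).

Lemma dotC u v : dot u v = dot v u.
Proof. by apply: eq_bigr => i _; rewrite mulrC. Qed.

Lemma dotDl u v w : dot (u + v) w = dot u w + dot v w.
Proof. by rewrite -big_split; apply: eq_bigr => i _; rewrite !mxE mulrDl. Qed.

Lemma dotZl a u v : dot (a *: u) v = a * dot u v.
Proof. by rewrite /dot mulr_sumr; apply: eq_bigr => i _; rewrite !mxE mulrA. Qed.

Lemma dotDr u v w : dot u (v + w) = dot u v + dot u w.
Proof. by rewrite dotC dotDl !(dotC u). Qed.

Lemma dotZr a u v : dot u (a *: v) = a * dot u v.
Proof. by rewrite dotC dotZl dotC. Qed.

Lemma dotNl u v : dot (- u) v = - dot u v.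
Proof. by rewrite -scaleN1r dotZl mulN1r. Qed.

Lemma dotNr u v : dot u (- v) = - dot u v.
Proof. by rewrite dotC dotNl dotC. Qed.

Lemma dot0l u : dot 0 u = 0.
Proof. by rewrite -(scale0r u) dotZl mul0r. Qed.

Lemma dot0r u : dot u 0 = 0.
Proof. by rewrite dotC dot0l. Qed.

Definition dotE := (dotDl, dotDr, dotNl, dotNr, dotZl, dotZr, dot0l, dot0r).

Lemma dot_ge0 u : 0 <= dot u u.
Proof. by apply: sumr_ge0 => i _; rewrite -expr2 sqr_ge0. Qed.

Lemma dot_eq0 u : dot u u = 0 -> u = 0.
Proof.
move=> /eqP; rewrite psumr_eq0; last by move=> i _; rewrite -expr2 sqr_ge0.
move=> /allP u0; apply/rowP => i; rewrite mxE; apply/eqP.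
by have := u0 i (mem_index_enum _); rewrite /= mulf_eq0 orbb.
Qed.

Lemma enorm_ge0 u : 0 <= enorm u.
Proof. exact: sqrtr_ge0. Qed.
Hint Resolve enorm_ge0 : core.

Lemma enorm2 u : enorm u ^+ 2 = dot u u.
Proof. by rewrite sqr_sqrtr// dot_ge0. Qed.

Lemma enorm_eq0 u : enorm u = 0 -> u = 0.
Proof. by move=> u0; apply: dot_eq0; rewrite -enorm2 u0 expr0n. Qed.

Lemma enorm0 : enorm (0 : 'rV[R]_n) = 0.
Proof. by rewrite /enorm dot0l sqrtr0. Qed.

Lemma enormZ a u : enorm (a *: u) = `|a| * enorm u.
Proof. by rewrite /enorm dotZl dotZr mulrA -expr2 sqrtrM ?sqr_ge0// sqrtr_sqr. Qed.

Lemma enormN u : enorm (- u) = enorm u.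
Proof. by rewrite /enorm dotNl dotNr opprK. Qed.

Lemma enormC u v : enorm (u - v) = enorm (v - u).
Proof. by rewrite -enormN opprB. Qed.

Lemma CauchySchwarz2 u v : dot u v ^+ 2 <= dot u u * dot v v.
Proof.
have := dot_ge0 (dot v v *: u - dot u v *: v).
rewrite !dotE (dotC v u) => h.
have : 0 <= dot v v * (dot u u * dot v v - dot u v ^+ 2) by move: h; lra.
move=> {h}; have [/dot_eq0 -> _|v0] := eqVneq (dot v v) 0; first by rewrite !dot0r expr0n mulr0.
by rewrite pmulr_rge0 ?subr_ge0// lt_def v0 dot_ge0.
Qed.

Lemma CauchySchwarz u v : `|dot u v| <= enorm u * enorm v.
Proof.
rewrite -sqrtr_sqr -sqrtrM ?dot_ge0//; apply: ler_wsqrtr; exact: CauchySchwarz2.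
Qed.

Lemma enorm_le u a : 0 <= a -> dot u u <= a ^+ 2 -> enorm u <= a.
Proof. by move=> a0 ua; rewrite -(ger0_norm a0) -sqrtr_sqr ler_wsqrtr. Qed.

Lemma enormD u v : enorm (u + v) <= enorm u + enorm v.
Proof.
apply: enorm_le; first by rewrite addr_ge0.
rewrite sqrrD !enorm2 !dotE (dotC v u).
have := CauchySchwarz u v; have := ler_norm (dot u v); lra.
Qed.

Lemma enormB u v : enorm (u - v) <= enorm u + enorm v.
Proof. by rewrite -(enormN v) enormD. Qed.

Lemma enorm_tri u v w : enorm (u - w) <= enorm (u - v) + enorm (v - w).
Proof. by have := enormD (u - v) (v - w); rewrite addrA subrK. Qed.

Lemma enorm_gt0 u : u != 0 -> 0 < enorm u.
Proof.
by move=> u0; rewrite lt_def enorm_ge0 andbT; apply: contra u0 => /eqP/enorm_eq0/eqP.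
Qed.

Lemma enorm1 u : dot u u = 1 -> enorm u = 1.
Proof. by move=> u1; rewrite /enorm u1 sqrtr1. Qed.

Lemma dot_unit_le u v : dot u u = 1 -> `|dot u v| <= enorm v.
Proof. by move=> u1; have := CauchySchwarz u v; rewrite (enorm1 u1) mul1r. Qed.

Lemma normalize_unit u : u != 0 -> dot ((enorm u)^-1 *: u) ((enorm u)^-1 *: u) = 1.
Proof.
move=> u0; rewrite dotZl dotZr -enorm2; field.
by rewrite gt_eqF// enorm_gt0.
Qed.

(** With [enorm_le_mx_norm] below, the Euclidean and the sup norm have the same
 topology. *)
Lemma mx_norm_le_enorm u : `|u| <= enorm u.
Proof.
rewrite [leLHS]/Num.Def.normr/= mx_normrE; apply: bigmax_le => //= -[i j] _ /=.
rewrite -sqrtr_sqr ler_wsqrtr// [i]ord1 /dot (bigD1 j)//= expr2 lerDl.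
by apply: sumr_ge0 => k _; rewrite -expr2 sqr_ge0.
Qed.

End Euclid.
#[global] Hint Extern 0 (is_true (0 <= enorm _)) => exact: enorm_ge0 : core.

(** * Cross product and determinant in space *)

Section Space.
Context {R : realType}.
Implicit Types (u v w x y z : 'rV[R]_3) (a b c : R).

Lemma dot3E u v : dot u v = u 0 0 * v 0 0 + u 0 1 * v 0 1 + u 0 2 * v 0 2.
Proof.
rewrite /dot !big_ord_recl big_ord0 addr0 addrA.
by congr (_ * _ + _ * _ + _ * _); congr (_ _ _); apply: val_inj.
Qed.

Lemma enorm_le_mx_norm u : enorm u <= 2 * `|u|.
Proof.
have h i : u 0 i * u 0 i <= `|u| ^+ 2.
  rewrite -expr2 -ler_sqrt ?exprn_ge0// !sqrtr_sqr (ger0_norm (normr_ge0 _)).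
  by rewrite [leRHS]/Num.Def.normr/= mx_normrE; apply/bigmax_geP; right => /=; exists (0, i).
apply: enorm_le; first by rewrite mulr_ge0.
rewrite dot3E; have := (h 0, h 1, h 2) => -[[]]; nra.
Qed.

Definition vec3 a b c : 'rV[R]_3 := \row_i [:: a; b; c]`_i.

Lemma vec30 a b c : vec3 a b c 0 0 = a. Proof. by rewrite mxE. Qed.
Lemma vec31 a b c : vec3 a b c 0 1 = b. Proof. by rewrite mxE. Qed.
Lemma vec32 a b c : vec3 a b c 0 2 = c. Proof. by rewrite mxE. Qed.
Definition vec3E := (vec30, vec31, vec32).

Definition cross u v : 'rV[R]_3 :=
  vec3 (u 0 1 * v 0 2 - u 0 2 * v 0 1) (u 0 2 * v 0 0 - u 0 0 * v 0 2)
       (u 0 0 * v 0 1 - u 0 1 * v 0 0).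

Definition det3 u v w : R := dot (cross u v) w.

Lemma dot_crossl u v : dot u (cross u v) = 0.
Proof. by rewrite dot3E !vec3E; ring. Qed.

Lemma dot_crossr u v : dot v (cross u v) = 0.
Proof. by rewrite dot3E !vec3E; ring. Qed.

Lemma lagrange_identity u v :
  dot (cross u v) (cross u v) = dot u u * dot v v - dot u v ^+ 2.
Proof. by rewrite !dot3E !vec3E; ring. Qed.

Lemma det_mx22 (A : 'M[R]_2) : \det A = A 0 0 * A 1 1 - A 0 1 * A 1 0.
Proof.
rewrite (expand_det_row _ 0) !big_ord_recl big_ord0 /cofactor !det_mx11 !mxE /=.
rewrite addr0 !add0n expr0 expr1 mul1r mulN1r mulrN.
by congr (_ * _ - _ * _); congr (A _ _); apply: val_inj.
Qed.

Lemma det3E u v w : \det (\matrix_(i < 3) [:: u; v; w]`_i) = det3 u v w.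
Proof.
rewrite (expand_det_row _ 0) !big_ord_recl big_ord0 /cofactor !det_mx22 !mxE /=.
rewrite /det3 dot3E !vec3E.
have e1 : lift ord0 (lift ord0 ord0) = 2 :> 'I_3 by apply: val_inj.
have e2 : lift ord0 ord0 = 1 :> 'I_3 by apply: val_inj.
have e3 : lift ord0 0 = 1 :> 'I_3 by apply: val_inj.
have e4 : lift ord0 1 = 2 :> 'I_3 by apply: val_inj.
have e5 : lift 1 0 = 0 :> 'I_3 by apply: val_inj.
have e6 : lift 1 1 = 2 :> 'I_3 by apply: val_inj.
have e7 : lift 2 0 = 0 :> 'I_3 by apply: val_inj.
have e8 : lift 2 1 = 1 :> 'I_3 by apply: val_inj.
have e9 : ord0 = 0 :> 'I_3 by apply: val_inj.
rewrite !(e1, e2, e3, e4, e5, e6, e7, e8) e9 /bump /= !add0n expr0 expr1 sqrrN.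
ring.
Qed.

(** The determinant is a triple product, and Lagrange's identity bounds the cross
 product. *)
Lemma hadamard u v w : `|det3 u v w| <= enorm u * enorm v * enorm w.
Proof.
apply: le_trans (CauchySchwarz _ _) _; apply: ler_wpM2r => //.
apply: enorm_le; first by rewrite mulr_ge0.
rewrite lagrange_identity exprMn !enorm2; have := sqr_ge0 (dot u v); lra.
Qed.

(** Rotate the first two coordinates by a right angle, unless they both vanish. *)
Lemma orthogonal_unit u : exists2 v, dot v v = 1 & dot u v = 0.
Proof.
have [/eqP p0|p0] := eqVneq (u 0 0 ^+ 2 + u 0 1 ^+ 2) 0.
  move: p0; rewrite paddr_eq0 ?sqr_ge0// !sqrf_eq0 => /andP[/eqP u0 /eqP u1].
  exists (vec3 1 0 0); first by rewrite dot3E !vec3E; ring.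
  by rewrite dot3E !vec3E u0; ring.
set v := vec3 (- u 0 1) (u 0 0) 0.
have vv : dot v v = u 0 0 ^+ 2 + u 0 1 ^+ 2 by rewrite dot3E !vec3E; ring.
have v0 : v != 0 by apply: contra p0 => /eqP v0; rewrite -vv v0 dot0l.
exists ((enorm v)^-1 *: v); first exact: normalize_unit.
by rewrite dotZr dot3E !vec3E; ring.
Qed.

Lemma orthonormal_pair (e : 'rV[R]_3) : dot e e = 1 -> exists a b : 'rV[R]_3,
  [/\ dot a a = 1, dot b b = 1, dot a b = 0, dot a e = 0 & dot b e = 0].
Proof.
move=> e1; have [a a1 ea] := orthogonal_unit e.
exists a, (cross e a); split=> //; rewrite ?dot_crossr//.
- by rewrite lagrange_identity e1 a1 ea; ring.
- by rewrite dotC.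
- by rewrite dotC dot_crossl.
Qed.

(** Multilinearity replaces the vectors one at a time, each change costing at
 most the product of the three lengths. *)
Lemma det3_perturb u v w u' v' w' (d e : R) : 0 <= e <= d ->
  enorm u <= d -> enorm v <= d -> enorm w <= d ->
  enorm (u' - u) <= e -> enorm (v' - v) <= e -> enorm (w' - w) <= e ->
  `|det3 u v w| - 12 * e * d ^+ 2 <= `|det3 u' v' w'|.
Proof.
move=> /andP[e0 ed] ud vd wd u'e v'e w'e.
have b (x y : 'rV[R]_3) : enorm x <= d -> enorm (y - x) <= e -> enorm y <= 2 * d.
  by move=> xd yx; have := enormD (y - x) x; rewrite subrK; lra.
have u'd := b _ _ ud u'e; have v'd := b _ _ vd v'e; have w'd := b _ _ wd w'e.
have E : det3 u v w = det3 u' v' w' - det3 (u' - u) v' w' - det3 u (v' - v) w' -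
    det3 u v (w' - w).
  by rewrite /det3 !dot3E !vec3E !mxE; ring.
have h x y z (p q r : R) : enorm x <= p -> enorm y <= q -> enorm z <= r ->
    `|det3 x y z| <= p * q * r.
  move=> xp yq zr; apply: le_trans (hadamard _ _ _) _.
  by rewrite !ler_pM// ?mulr_ge0.
have h1 := h _ _ _ _ _ _ u'e v'd w'd.
have h2 := h _ _ _ _ _ _ ud v'e w'd.
have h3 := h _ _ _ _ _ _ ud vd w'e.
have d0 : 0 <= d by apply: le_trans ed.
have := ler_normB (det3 u' v' w' - det3 (u' - u) v' w' - det3 u (v' - v) w')
  (det3 u v (w' - w)).
have := ler_normB (det3 u' v' w' - det3 (u' - u) v' w') (det3 u (v' - v) w').
have := ler_normB (det3 u' v' w') (det3 (u' - u) v' w').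
have := mulr_ge0 e0 (sqr_ge0 d); rewrite -E; lra.
Qed.

(** Bessel's inequality for [p] and a unit vector orthogonal to it. *)
Lemma bessel_cross (p q nu : 'rV[R]_3) : dot nu nu = 1 -> dot p nu = 0 ->
  dot nu q ^+ 2 * dot p p <= dot (cross p q) (cross p q).
Proof.
move=> nu1 pnu; rewrite lagrange_identity.
have := dot_ge0 (dot p p *: q - (dot p p * dot nu q) *: nu - dot p q *: p).
rewrite !dotE (dotC q p) (dotC q nu) (dotC nu p) pnu nu1 => h.
have [/dot_eq0 -> |p0] := eqVneq (dot p p) 0; first by rewrite !dot0l; lra.
have {}p0 : 0 < dot p p by rewrite lt_def p0 dot_ge0.
rewrite -subr_ge0 -(pmulr_rge0 _ p0); move: h; lra.
Qed.

End Space.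

(** * Hausdorff measure is a metric outer measure *)

Section HausdorffMeasure.
Context {R : realType}.
Implicit Types (A B X : set 'rV[R]_3) (d : R).

Lemma ediam_le A (r : R) : 0 <= r ->
  (forall x y, A x -> A y -> enorm (x - y) <= r) -> (ediam A <= r%:E)%E.
Proof.
move=> r0 Ar; apply: ge_ereal_sup => _ [->|[x Ax [y Ay <-]]]; rewrite lee_fin//.
exact: Ar.
Qed.

Lemma enorm_le_ediam A x y : A x -> A y -> ((enorm (x - y))%:E <= ediam A)%E.
Proof. by move=> Ax Ay; apply: ereal_sup_ubound; right; exists x => //; exists y. Qed.

Lemma content_le_hausdorff2 d A : 0 < d -> (hausdorff2_content d A <= hausdorff2 A)%E.
Proof. by move=> d0; apply: ereal_sup_ubound; exists d. Qed.

Lemma content_antitone d d' A : d <= d' ->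
  (hausdorff2_content d' A <= hausdorff2_content d A)%E.
Proof.
move=> dd'; apply: le_ereal_inf_tmp => _ [F [Fd AF] <-].
apply: ereal_inf_lbound; exists F => //; split=> // k.
by apply: le_trans (Fd k) _; rewrite lee_fin.
Qed.

Lemma content_ge0 d A : (0 <= hausdorff2_content d A)%E.
Proof.
apply: le_ereal_inf_tmp => _ [F _ <-]; apply: nneseries_ge0 => k _ _.
exact: hausdorff2_weight_ge0.
Qed.

Lemma weight0 : ((pi / 4)%:E * ediam (set0 : set 'rV[R]_3) ^+ 2 = 0)%E.
Proof. by rewrite ediam0 expe2 !mule0. Qed.

(** A set of diameter at most [d] meets at most one of two sets more than [d]
 apart, so a fine cover of the union splits into covers of the two sets. *)
Lemma content_separated d A B : 0 <= d ->
  (forall x y, A x -> B y -> d < enorm (x - y)) ->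
  (hausdorff2_content d A + hausdorff2_content d B
     <= hausdorff2_content d (A `|` B))%E.
Proof.
move=> d0 AB; apply: le_ereal_inf_tmp => _ [F [Fd ABF] <-].
pose part C k := if `[< (F k `&` C) !=set0 >] then F k else set0.
have part_le C k : (ediam (part C k) <= d%:E)%E.
  by rewrite /part; case: ifP => _; rewrite ?ediam0 ?lee_fin.
have part_cover C : C `<=` A `|` B -> C `<=` \bigcup_k part C k.
  move=> CAB x Cx; have [k _ Fx] := ABF _ (CAB _ Cx); exists k => //.
  by rewrite /part; case: asboolP => // -[]; exists x.
have le_part C : C `<=` A `|` B -> (hausdorff2_content d C <=
    \sum_(0 <= k <oo) (pi / 4)%:E * ediam (part C k) ^+ 2)%E.
  by move=> CAB; apply: ereal_inf_lbound; exists (part C) => //; split=> //; exact: part_cover.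
have /le_trans := leeD (le_part A (@subsetUl _ A B)) (le_part B (@subsetUr _ A B)).
apply; rewrite -nneseriesD; try by move=> *; exact: hausdorff2_weight_ge0.
apply: lee_nneseries => k _.
  by move=> _; apply: adde_ge0; exact: hausdorff2_weight_ge0.
rewrite /part; case: asboolP => [[x [Fx Ax]]|_]; case: asboolP => [[y [Fy By]]|_].
- have := le_trans (enorm_le_ediam Fx Fy) (Fd k).
  by rewrite lee_fin leNgt AB.
- by rewrite weight0 adde0.
- by rewrite weight0 add0e.
- by rewrite weight0 add0e hausdorff2_weight_ge0.
Qed.

(** Suprema of nonnegative extended reals: if [z] is finite then both suprema are,
 and they can be moved across the inequality one after the other. *)
Lemma ereal_sup_add_le (S T : set \bar R) (z : \bar R) :
  (exists2 a, S a & 0 <= a)%E -> (forall t, T t -> 0 <= t)%E ->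
  (forall s t, S s -> T t -> s + t <= z)%E -> (exists2 b, T b & 0 <= b)%E ->
  (forall s, S s -> 0 <= s)%E -> (ereal_sup S + ereal_sup T <= z)%E.
Proof.
move=> [a Sa a0] T0 ST [b Tb b0] S0.
case: z ST => [z| |] ST; last 2 first.
- by rewrite leey.
- by have := ST _ _ Sa Tb; rewrite leeNy_eq => /eqP h; have := adde_ge0 a0 b0; rewrite h.
have finS s : S s -> s \is a fin_num.
  move=> Ss; rewrite ge0_fin_numE ?S0//; apply: (@le_lt_trans _ _ z%:E); last exact: ltry.
  by apply: le_trans (ST _ _ Ss Tb); rewrite leeDl.
have finT s : T s -> s \is a fin_num.
  move=> Ss; rewrite ge0_fin_numE ?T0//; apply: (@le_lt_trans _ _ z%:E); last exact: ltry.
  by apply: le_trans (ST _ _ Sa Ss); rewrite leeDr.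
have supS t : T t -> (ereal_sup S <= z%:E - t)%E.
  move=> Tt; apply: ge_ereal_sup => s Ss; rewrite leeBrDr ?finT//; exact: ST.
have supS0 : (0 <= ereal_sup S)%E by apply: le_trans a0 _; exact: ereal_sup_ubound.
have finsup : ereal_sup S \is a fin_num.
  rewrite ge0_fin_numE//; apply: le_lt_trans (supS _ Tb) _.
  by apply: (@le_lt_trans _ _ z%:E); [rewrite leeBlDr ?finT// leeDl|exact: ltry].
rewrite addeC -leeBrDr//; apply: ge_ereal_sup => t Tt.
by rewrite leeBrDr// addeC -leeBrDr ?finT// supS.
Qed.

Lemma hausdorff2_separated d A B : 0 < d ->
  (forall x y, A x -> B y -> d < enorm (x - y)) ->
  (hausdorff2 A + hausdorff2 B <= hausdorff2 (A `|` B))%E.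
Proof.
move=> d0 AB; apply: ereal_sup_add_le.
- by exists (hausdorff2_content 1 A); [exists 1 => //=|exact: content_ge0].
- by move=> _ [e _ <-]; exact: content_ge0.
- move=> _ _ [e /= e0 <-] [e' /= e'0 <-].
  pose m := Num.min d (Num.min e e').
  have m0 : 0 < m by rewrite !lt_min d0 e0.
  apply: le_trans (content_le_hausdorff2 _ m0).
  apply: le_trans (content_separated (ltW m0) _); last first.
    by move=> x y Ax By; apply: le_lt_trans (AB _ _ Ax By); rewrite ge_min lexx.
  by apply: leeD; apply: content_antitone; rewrite !ge_min lexx ?orbT.
- by exists (hausdorff2_content 1 B); [exists 1 => //=|exact: content_ge0].
- by move=> _ [e _ <-]; exact: content_ge0.
Qed.

End HausdorffMeasure.

(** * Closed sets are measurable *)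

Section Caratheodory.
Context {R : realType}.
(** Caratheodory's criterion for a set [g <= 0]. The part of [X] where [g] is positive
 is cut into layers by the thresholds [t k], which decrease to zero. Two layers of
 the same parity are a positive distance apart, so that the measures of the layers
 of each parity sum to at most the measure of [X]; hence the layers close to [g = 0]
 are negligible, and what remains is a positive distance away from [g <= 0]. *)
Variables (g : 'rV[R]_3 -> R) (X : set 'rV[R]_3).
Hypothesis g1 : forall x y, g x - g y <= enorm (x - y).

Let t k : R := k.+1%:R^-1.
Let t_gt0 k : 0 < t k. Proof. by rewrite invr_gt0. Qed.
Let t_lt k : t k.+1 < t k.
Proof. by rewrite ltf_pV2 ?posrE// ltr_nat. Qed.

Let above (r : R) := X `&` [set x | r < g x].
Let layer k := X `&` [set x | t k.+1 < g x <= t k].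

Let below_above a b Y Z : a < b ->
  Y `<=` X `&` [set x | g x <= a] -> Z `<=` above b ->
  (hausdorff2 Z + hausdorff2 Y <= hausdorff2 (Z `|` Y))%E.
Proof.
move=> ab Ya Zb; apply: (@hausdorff2_separated _ ((b - a) / 2)).
  by rewrite divr_gt0// subr_gt0.
move=> x y /Zb[_ /= gx] /Ya[_ /= gy]; have := g1 x y; lra.
Qed.

(** Every other layer: two of them are separated by the layer in between. *)
Let sum_layers j m : (\sum_(0 <= k < m) hausdorff2 (layer (k.*2.+1 + j))
  <= hausdorff2 (above (t (m.*2 + j))))%E.
Proof.
elim: m => [|m IH]; first by rewrite big_nil hausdorff2_ge0.
rewrite big_nat_recr//=; apply: le_trans (leeD2r _ IH) _.
apply: (@le_trans _ _ (hausdorff2 (above (t (m.*2 + j)) `|` layer (m.*2.+1 + j)))).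
  apply: (@below_above (t (m.*2.+1 + j)) (t (m.*2 + j))) => //.
    by rewrite addSn t_lt.
  by move=> x [Xx /andP[_ xt]].
apply: le_hausdorff2 => x [[Xx xt]|[Xx /andP[xt _]]]; split=> //.
by rewrite /= doubleS !addSn (lt_trans (t_lt _))// (lt_trans (t_lt _)).
Qed.

Let series_layers j : (\sum_(0 <= k <oo) hausdorff2 (layer (k.*2.+1 + j))
  <= hausdorff2 X)%E.
Proof.
apply: lime_le; first by apply: is_cvg_nneseries => k _ _; exact: hausdorff2_ge0.
apply: nearW => m; apply: le_trans (sum_layers _ _) _.
by apply: le_hausdorff2 => x [].
Qed.

Let tail j n : \bar R := (\sum_(n <= k <oo) hausdorff2 (layer (k.*2.+1 + j)))%E.

Let positive_cover n : (hausdorff2 (X `&` [set x | 0 < g x]%R)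
  <= hausdorff2 (above (t n.*2.+1)) + (tail 0 n + tail 1 n))%E.
Proof.
pose L j := \bigcup_k layer ((k + n).*2.+1 + j).
have Ltail j : (hausdorff2 (L j) <= tail j n)%E.
  rewrite /tail -(@nneseries_addn _ (fun k => hausdorff2 (layer (k.*2.+1 + j)))).
    exact: hausdorff2_sigma_subadditive.
  by move=> k; exact: hausdorff2_ge0.
apply: (@le_trans _ _ (hausdorff2 (above (t n.*2.+1) `|` (L 0%N `|` L 1%N)))).
  apply: le_hausdorff2 => x [Xx /= gx].
  have [xt|xt] := ltP (t n.*2.+1) (g x); first by left.
  right.
  (* The layer of [x] is given by the first threshold below [g x]. *)
  have ex : exists k, t k.+1 < g x.
    have [k _ /(_ _ (leqnn _)) kP] := near_infty_natSinv_lt (PosNum gx).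
    by exists k; apply: lt_trans (t_lt _) kP.
  have [k kg kmin] := ex_minnP ex.
  have nk : (n.*2.+1 <= k)%N.
    rewrite leqNgt; apply/negP => kn; move: xt; rewrite leNgt => /negP; apply.
    apply: le_lt_trans kg; rewrite /t lef_pV2 ?posrE// ler_nat ltnS.
    exact: kn.
  have gk : g x <= t k.
    case: k kg kmin nk => // k kg kmin nk; rewrite leNgt; apply/negP => /kmin.
    by rewrite ltnn.
  have lk : layer k x by split=> //; rewrite /= kg gk.
  move: nk lk; rewrite -(odd_double_half k); case: (odd k) => /=.
    rewrite add1n ltnS leq_double => nk lk; left; exists (k./2 - n)%N => //.
    by rewrite subnK// addn0.
  rewrite add0n; case: (k./2) => // h; rewrite doubleS ltnS => nk lk; right.
  have nh : (n <= h)%N by rewrite -ltnS -ltn_double doubleS ltnS.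
  by exists (h - n)%N => //; rewrite subnK// addn1.
have U2 (P Q : set 'rV[R]_3) : (hausdorff2 (P `|` Q) <= hausdorff2 P + hausdorff2 Q)%E.
  exact: (outer_measureU2 (@hausdorff2_outer R)).
by apply: le_trans (U2 _ _) _; apply: leeD => //; apply: le_trans (U2 _ _) _; exact: leeD.
Qed.

Lemma caratheodory_split :
  (hausdorff2 (X `&` [set x | g x <= 0]%R) + hausdorff2 (X `&` [set x | 0 < g x]%R)
     <= hausdorff2 X)%E.
Proof.
have [->|Xoo] := eqVneq (hausdorff2 X) +oo%E; first by rewrite leey.
have {}Xoo : (hausdorff2 X < +oo)%E by rewrite ltey.
have tail0 j : tail j n @[n --> \oo] --> 0%E.
  apply: nneseries_tail_cvg; last by move=> *; exact: hausdorff2_ge0.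
  by apply: le_lt_trans Xoo; exact: series_layers.
have tails : (hausdorff2 X + (tail 0 n + tail 1 n))%E @[n --> \oo] -->
    (hausdorff2 X + (0 + 0))%E.
  apply: cvgeD; [|exact: cvg_cst|]; first by rewrite adde0 fin_num_adde_defl.
  by apply: cvgeD; [|exact: tail0|exact: tail0].
have -> : hausdorff2 X = (hausdorff2 X + (0 + 0))%E by rewrite !adde0.
rewrite -(cvg_lim _ tails)//.
apply: lime_ge; first by apply/cvg_ex; eexists; exact: tails.
apply: nearW => n; apply: le_trans (leeD2l _ (positive_cover n)) _.
rewrite addeA; apply: leeD2r; rewrite addeC.
apply: le_trans (below_above (t_gt0 n.*2.+1) _ _) _ => //.
by apply: le_hausdorff2 => x [[]|[]].
Qed.

End Caratheodory.

Section ClosedMeasurable.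
Context {R : realType}.
Implicit Types A : set 'rV[R]_3.

(** The distance to [A] is 1-Lipschitz and vanishes only on [A]. *)
Lemma closed_caratheodory A : closed A -> (@hausdorff2_outer R).-caratheodory A.
Proof.
move=> clA; have [->|A0] := eqVneq A set0; first exact: caratheodory_measurable_set0.
move/set0P : A0 => [a Aa].
pose D x := [set enorm (x - y) | y in A].
have D0 x : has_inf (D x).
  split; first by exists (enorm (x - a)), a.
  by exists 0 => _ [y _ <-].
pose g x := inf (D x).
have g1 x y : g x - g y <= enorm (x - y).
  rewrite lerBlDl -lerBlDr; apply: lb_le_inf; first exact: (D0 y).1.
  move=> _ [z Az <-]; rewrite lerBlDr.
  apply: (@le_trans _ _ (enorm (x - z))).
    by apply: ge_inf; [exact: (D0 x).2|exists z].
  by have := enorm_tri x y z; lra.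
have gA : [set x | g x <= 0] = A.
  apply/seteqP; split=> x /=; last first.
    move=> Ax; apply: le_trans (_ : enorm (x - x) <= 0); last by rewrite subrr enorm0.
    by apply: ge_inf; [exact: (D0 x).2|exists x].
  move=> gx; apply: clA => U /nbhs_ballP[e /= e0 eU].
  have [_ [y Ay <-] ye] := inf_adherent e0 (D0 x).
  exists y; split=> //; apply: eU; rewrite mx_norm_ball /ball_ /=.
  by apply: le_lt_trans (mx_norm_le_enorm _) _; apply: lt_le_trans ye _; rewrite /g in gx; lra.
apply: le_caratheodory_measurable => X; rewrite -gA.
have -> : ~` [set x | g x <= 0] = [set x | 0 < g x].
  by apply/seteqP; split=> x /=; rewrite ltNge => /negP.
exact: caratheodory_split.
Qed.

End ClosedMeasurable.

(** * Lower bounds for the measure by projection *)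

Section Projection.
Context {R : realType}.
Implicit Types (A : set 'rV[R]_3) (l : R).

Let area : {measure set (measurableTypeR R * measurableTypeR R) -> \bar R} :=
  (@lebesgue_measure R \x @lebesgue_measure R)%E.

Let itv (x r : R) : set (measurableTypeR R) := `[x - r, x + r]%classic.

Let square (p : R * R) (r : R) : set (measurableTypeR R * measurableTypeR R) :=
  itv p.1 r `*` itv p.2 r.

Let measurable_square p r : measurable (square p r).
Proof. by apply: measurableX; exact: measurable_itv. Qed.

Let area_square p r : 0 <= r -> area (square p r) = (4 * r ^+ 2)%:E.
Proof.
move=> r0.
have -> : area (square p r) = (lebesgue_measure (itv p.1 r) * lebesgue_measure (itv p.2 r))%E.
  by apply: product_measure1E; exact: measurable_itv.
have h x : lebesgue_measure (itv x r) = (2 * r)%:E.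
  rewrite lebesgue_measure_itv /= lte_fin; case: ltP => xr.
    by rewrite -EFinB; congr _%:E; ring.
  by congr _%:E; lra.
by rewrite !h -EFinM; congr _%:E; ring.
Qed.

(** Projecting along the pair [a], [b] does not increase diameters, and a plane
 set of diameter [d] lies in a square of area [4 * d ^+ 2]. *)
Lemma hausdorff2_projection A (x a b : 'rV[R]_3) l : 0 <= l ->
  dot a a = 1 -> dot b b = 1 ->
  (forall s t, `|s| <= l -> `|t| <= l ->
     exists2 y, A y & dot a (y - x) = s /\ dot b (y - x) = t) ->
  ((pi / 4 * l ^+ 2)%:E <= hausdorff2 A)%E.
Proof.
move=> l0 a1 b1 Al; apply: le_trans (content_le_hausdorff2 _ (@ltr01 R)).
apply: le_ereal_inf_tmp => _ [F [Fd AF] <-].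
pose d k := fine (ediam (F k)).
have dE k : ediam (F k) = (d k)%:E.
  rewrite /d fineK// ge0_fin_numE ?ediam_ge0//.
  by apply: le_lt_trans (Fd k) _; exact: ltry.
have d0 k : 0 <= d k by rewrite -lee_fin -dE ediam_ge0.
pose p k := let y := xget x (F k) in (dot a (y - x), dot b (y - x)).
have cover : square (0, 0) l `<=` \bigcup_k square (p k) (d k).
  move=> [s t] [/=]; rewrite /itv /= !in_itv /= !sub0r !add0r -!ler_norml => sl tl.
  have [y Ay [<- <-]] := Al _ _ sl tl; have [k _ Fy] := AF _ Ay; exists k => //.
  have Fx : F k (xget x (F k)) by apply: xgetPex; exists y.
  have yx : enorm (y - xget x (F k)) <= d k.
    by rewrite -lee_fin -dE; exact: enorm_le_ediam.
  have close c : dot c c = 1 ->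
      `|dot c (y - x) - dot c (xget x (F k) - x)| <= d k.
    move=> c1; apply: le_trans yx; apply: le_trans (dot_unit_le _ c1).
    by rewrite !dotE le_eqVlt; apply/orP; left; apply/eqP; congr `|_|; ring.
  by split; rewrite /itv /= in_itv /= -ler_distl; exact: close.
have := measure_sigma_subadditive area (fun k => measurable_square (p k) (d k))
  (measurable_square (0, 0) l) cover.
rewrite area_square// => /(lee_wpmul2l (_ : (0 <= (pi / 16)%:E :> \bar R)%E)) h.
have {}h := h (_ : (0 <= (pi / 16)%:E)%E); move: h.
rewrite -EFinM -nneseriesZl; last by move=> k _; exact: measure_ge0.
have -> : pi / 16 * (4 * l ^+ 2) = pi / 4 * l ^+ 2 by field.
move=> h; apply: le_trans (h _) _.
  by rewrite lee_fin divr_ge0// pi_ge0.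
apply: lee_nneseries => k _.
  by move=> _; apply: mule_ge0; [rewrite lee_fin divr_ge0// pi_ge0|exact: measure_ge0].
rewrite area_square// dE -EFin_expe -!EFinM lee_fin.
by rewrite le_eqVlt; apply/orP; left; apply/eqP; field.
Qed.

End Projection.

(** * Lower bounds for iterated integrals *)

Section IteratedIntegral.
Local Open Scope ereal_scope.
Context d (T : measurableType d) (R : realType) (mu : {measure set T -> \bar R}).

(** Monotonicity straight from the definition of the integral as a supremum: a simple
 function below [g] is below [h] on [S]. *)
Lemma le_integral_below (S : set T) (g h : T -> \bar R) :
  (forall x, 0 <= g x) -> (forall x, S x -> 0 <= h x) ->
  (forall x, g x <= (h \_ S) x) ->
  \int[mu]_x g x <= \int[mu]_(x in S) h x.
Proof.
move=> g0 h0 gh; rewrite ge0_integralTE// ge0_integralE//.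
apply: ereal_sup_le => _ [f /= fg <-]; exists f => // x.
exact: le_trans (fg x) (gh x).
Qed.

Lemma integral_ge_sum (S : set T) (N : nat) (A : 'I_N -> set T)
    (k : 'I_N -> \bar R) (h : T -> \bar R) :
  (forall i, measurable (A i)) -> (forall i, A i `<=` S) -> (forall i, 0 <= k i) ->
  (forall x, S x -> \sum_i k i * (\1_(A i) x)%:E <= h x) ->
  \sum_i k i * mu (A i) <= \int[mu]_(x in S) h x.
Proof.
move=> mA AS k0 kh.
have g0 i x : 0 <= (cst (k i) \_ (A i)) x by rewrite patchE; case: ifP => // _; exact: k0.
have gE x : \sum_i (cst (k i) \_ (A i)) x = \sum_i k i * (\1_(A i) x)%:E.
  apply: eq_bigr => i _; rewrite patchE indicE.
  by case: ifP; rewrite ?mule1 ?mule0.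
have -> : \sum_i k i * mu (A i) = \int[mu]_x \sum_i (cst (k i) \_ (A i)) x.
  rewrite ge0_integral_sum//; last first.
    by move=> i; apply/(measurable_restrictT _ (mA i)); exact: measurable_cst.
  by apply: eq_bigr => i _; rewrite -integral_mkcond integral_cst.
apply: le_integral_below => [x|x Sx|x].
- exact: sume_ge0.
- by apply: le_trans (kh _ Sx); rewrite -gE; exact: sume_ge0.
- rewrite patchE; case: ifPn => xS.
    by rewrite gE; apply: kh; rewrite inE in xS.
  rewrite big1// => i _; rewrite patchE ifN//; apply: contra xS.
  by rewrite !inE; exact: AS.
Qed.

(** Each variable is integrated in turn, the product indicators of the remaining
 variables playing the role of coefficients. *)
Lemma iterated_integral_ge_sum (S : set T) (N : nat) (A0 A1 A2 A3 : 'I_N -> set T)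
    (k : 'I_N -> \bar R) (f : T -> T -> T -> T -> \bar R) :
  (forall i, [/\ measurable (A0 i), measurable (A1 i), measurable (A2 i) & measurable (A3 i)]) ->
  (forall i, [/\ A0 i `<=` S, A1 i `<=` S, A2 i `<=` S & A3 i `<=` S]) ->
  (forall i, 0 <= k i) ->
  (forall x0 x1 x2 x3, S x0 -> S x1 -> S x2 -> S x3 ->
     \sum_i k i * (\1_(A3 i) x3)%:E * (\1_(A2 i) x2)%:E * (\1_(A1 i) x1)%:E *
       (\1_(A0 i) x0)%:E <= f x0 x1 x2 x3) ->
  \sum_i k i * mu (A0 i) * mu (A1 i) * mu (A2 i) * mu (A3 i) <=
    \int[mu]_(x3 in S) \int[mu]_(x2 in S) \int[mu]_(x1 in S) \int[mu]_(x0 in S)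
      f x0 x1 x2 x3.
Proof.
move=> mA AS k0 kf.
have ind0 (A : set T) x : 0 <= (\1_A x)%:E :> \bar R by rewrite lee_fin.
apply: integral_ge_sum => [i|i|i|x3 S3].
- by case: (mA i).
- by case: (AS i).
- by rewrite !mule_ge0.
have -> : \sum_i k i * mu (A0 i) * mu (A1 i) * mu (A2 i) * (\1_(A3 i) x3)%:E =
    \sum_i (k i * (\1_(A3 i) x3)%:E * mu (A0 i) * mu (A1 i)) * mu (A2 i).
  by apply: eq_bigr => i _; rewrite -!muleA; congr (_ * _); rewrite !muleA muleC !muleA.
apply: integral_ge_sum => [i|i|i|x2 S2].
- by case: (mA i).
- by case: (AS i).
- by rewrite !mule_ge0.
have -> : \sum_i (k i * (\1_(A3 i) x3)%:E * mu (A0 i) * mu (A1 i)) * (\1_(A2 i) x2)%:E =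
    \sum_i (k i * (\1_(A3 i) x3)%:E * (\1_(A2 i) x2)%:E * mu (A0 i)) * mu (A1 i).
  by apply: eq_bigr => i _; rewrite -!muleA; congr (_ * (_ * _)); rewrite !muleA muleC !muleA.
apply: integral_ge_sum => [i|i|i|x1 S1].
- by case: (mA i).
- by case: (AS i).
- by rewrite !mule_ge0.
have -> : \sum_i (k i * (\1_(A3 i) x3)%:E * (\1_(A2 i) x2)%:E * mu (A0 i)) * (\1_(A1 i) x1)%:E =
    \sum_i (k i * (\1_(A3 i) x3)%:E * (\1_(A2 i) x2)%:E * (\1_(A1 i) x1)%:E) * mu (A0 i).
  by apply: eq_bigr => i _; rewrite -!muleA; congr (_ * (_ * (_ * _))); rewrite muleC.
apply: integral_ge_sum => [i|i|i|x0 S0].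
- by case: (mA i).
- by case: (AS i).
- by rewrite !mule_ge0.
exact: kf.
Qed.

End IteratedIntegral.

(** * Fat tetrahedra and their contribution to the energy *)

Section Curvature.
Context {R : realType}.
Implicit Types (x y : 'rV[R]_3) (S : set 'rV[R]_3) (d k : R).

Lemma ratio_gt0 k d (n : nat) : 0 < k -> 0 < d -> 0 < k / n.+1%:R / d.
Proof. by move=> k0 d0; rewrite divr_gt0// divr_gt0. Qed.

Definition fat_tetra k d x0 x1 x2 x3 : Prop :=
  [/\ enorm (x1 - x0) <= d, enorm (x2 - x0) <= d, enorm (x3 - x0) <= d &
      k * d ^+ 3 <= `|det3 (x1 - x0) (x2 - x0) (x3 - x0)|].

(** Cramer's rule: a normal vector orthogonal to three independent edges is zero. *)
Lemma noncoplanar x0 x1 x2 x3 : det3 (x1 - x0) (x2 - x0) (x3 - x0) != 0 ->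
  ~ coplanar x0 x1 x2 x3.
Proof.
move=> det0 [nu [c [nu0 [h0 h1 h2 h3]]]].
have E (u v w : 'rV[R]_3) : dot nu nu * det3 u v w =
    dot nu u * det3 nu v w + dot nu v * det3 nu w u + dot nu w * det3 nu u v.
  by rewrite /det3 !dot3E !vec3E; ring.
have := E (x1 - x0) (x2 - x0) (x3 - x0).
rewrite ![dot nu (_ - _)]dotDr !dotNr h0 h1 h2 h3 !subrr !mul0r !addr0 => /eqP.
rewrite mulf_eq0 (negbTE det0) orbF => /eqP/dot_eq0 nu_eq0.
by rewrite nu_eq0 eqxx in nu0.
Qed.

Lemma triangle_areaE x y z :
  triangle_area x y z = enorm (cross (y - x) (z - x)) / 2.
Proof. by rewrite /triangle_area /enorm lagrange_identity. Qed.

Lemma triangle_area_le x y z d :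
  enorm (y - x) <= d -> enorm (z - x) <= d -> triangle_area x y z <= d ^+ 2 / 2.
Proof.
move=> yd zd; rewrite triangle_areaE ler_wpM2r ?invr_ge0//.
have d0 : 0 <= d by apply: le_trans yd.
apply: enorm_le; first exact: sqr_ge0.
have h1 : dot (y - x) (y - x) <= d ^+ 2 by rewrite -enorm2 lerXn2r ?nnegrE.
have h2 : dot (z - x) (z - x) <= d ^+ 2 by rewrite -enorm2 lerXn2r ?nnegrE.
rewrite lagrange_identity; have := sqr_ge0 (dot (y - x) (z - x)).
have := ler_pM (dot_ge0 _) (dot_ge0 _) h1 h2; lra.
Qed.

Lemma tetra_area_gt0 x0 x1 x2 x3 : det3 (x1 - x0) (x2 - x0) (x3 - x0) != 0 ->
  0 < tetra_area x0 x1 x2 x3.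
Proof.
move=> det0; rewrite /tetra_area !triangle_areaE ltr_wpDl//.
  by rewrite !addr_ge0// divr_ge0.
rewrite divr_gt0// enorm_gt0//; apply: contra det0 => /eqP e.
by rewrite /det3 e dot0l.
Qed.

Lemma tetra_diam_bound x0 x1 x2 x3 d :
  (forall x y, [set x0; x1; x2; x3] x -> [set x0; x1; x2; x3] y -> enorm (x - y) <= d) ->
  enorm (x1 - x0) <= tetra_diam x0 x1 x2 x3 <= d.
Proof.
move=> xd; set X := [set x0; x1; x2; x3].
have X0 : X x0 by rewrite /X; left; left; left.
have X1 : X x1 by rewrite /X; left; left; right.
have d0 : 0 <= d by apply: le_trans (xd _ _ X0 X0).
have diam_d := ediam_le d0 xd; rewrite -/X in diam_d.
have fin : ediam X \is a fin_num.
  by rewrite ge0_fin_numE ?ediam_ge0// (le_lt_trans diam_d)// ltry.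
by rewrite -!lee_fin /tetra_diam fineK// diam_d andbT; exact: enorm_le_ediam.
Qed.

(** Each of the four faces has area at most [9 * d ^+ 2 / 2], and the diameter is at
 most [3 * d]; the constant 2000 exceeds [12 * 162]. *)
Lemma tetra_curvature_ge k d x0 x1 x2 x3 : 0 < k -> 0 < d ->
  (forall x y, [set x0; x1; x2; x3] x -> [set x0; x1; x2; x3] y ->
     enorm (x - y) <= 3 * d) ->
  k / 2 * d ^+ 3 <= `|det3 (x1 - x0) (x2 - x0) (x3 - x0)| ->
  k / 2000 / d <= tetra_curvature x0 x1 x2 x3.
Proof.
move=> k0 d0.
have p0 : 0 <= k / 2000 / d := ltW (ratio_gt0 1999 k0 d0).
move=> xd detk.
have det0 : det3 (x1 - x0) (x2 - x0) (x3 - x0) != 0.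
  rewrite -normr_gt0; apply: lt_le_trans detk.
  by rewrite mulr_gt0// ?divr_gt0// exprn_gt0.
rewrite /tetra_curvature asboolF; last exact: noncoplanar.
have /andP[diam_ge diam_le] := tetra_diam_bound xd.
have area0 := tetra_area_gt0 det0.
have diam0 : 0 < tetra_diam x0 x1 x2 x3.
  apply: lt_le_trans diam_ge; apply: enorm_gt0; apply: contra det0 => /eqP ->.
  by rewrite /det3 dot3E !vec3E !mxE; apply/eqP; ring.
have X0 : [set x0; x1; x2; x3] x0 by left; left; left.
have X1 : [set x0; x1; x2; x3] x1 by left; left; right.
have X2 : [set x0; x1; x2; x3] x2 by left; right.
have X3 : [set x0; x1; x2; x3] x3 by right.
have area_le : tetra_area x0 x1 x2 x3 <= 18 * d ^+ 2.
  have h x y z Xx Xy Xz := triangle_area_le (xd y x Xy Xx) (xd z x Xz Xx).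
  have := (h _ _ _ X1 X2 X3, h _ _ _ X0 X2 X3, h _ _ _ X0 X1 X3, h _ _ _ X0 X1 X2).
  by rewrite /tetra_area => -[[[]]]; lra.
have diam2_le : tetra_diam x0 x1 x2 x3 ^+ 2 <= 9 * d ^+ 2.
  have -> : 9 * d ^+ 2 = (3 * d) ^+ 2 by ring.
  by rewrite lerXn2r ?nnegrE// ?mulr_ge0// ltW.
have den_le := ler_pM (ltW area0) (sqr_ge0 _) area_le diam2_le.
rewrite ler_pdivlMr ?mulr_gt0// ?exprn_gt0// /tetra_volume det3E.
apply: (@le_trans _ _ (k / 2000 / d * (18 * d ^+ 2 * (9 * d ^+ 2)))).
  exact: (ler_wpM2l p0 den_le).
have -> : k / 2000 / d * (18 * d ^+ 2 * (9 * d ^+ 2)) = 162 / 2000 * (k * d ^+ 3).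
  by field; rewrite gt_eqF.
have : 0 < k * d ^+ 3 by rewrite mulr_gt0// exprn_gt0.
move: detk; lra.
Qed.

(** Fatness survives moving the vertices by a small fraction of the size. *)
Lemma fat_tetra_curvature k d x0 x1 x2 x3 y0 y1 y2 y3 : 0 < k <= 1 -> 0 < d ->
  fat_tetra k d x0 x1 x2 x3 ->
  enorm (y0 - x0) <= k / 100 * d -> enorm (y1 - x1) <= k / 100 * d ->
  enorm (y2 - x2) <= k / 100 * d -> enorm (y3 - x3) <= k / 100 * d ->
  k / 2000 / d <= tetra_curvature y0 y1 y2 y3.
Proof.
move=> /andP[k0 k1] d0 [x1d x2d x3d detk] yx0 yx1 yx2 yx3.
have kd : k / 100 * d <= d / 100 by rewrite mulrC mulrA ler_wpM2r// ler_piMr// ltW.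
have kd0 : 0 < k / 100 * d by rewrite mulr_gt0// divr_gt0.
have near0 x y : enorm (x - x0) <= d -> enorm (y - x) <= k / 100 * d ->
    enorm (y - x0) <= d + d / 100.
  by move=> xd yx; have := enorm_tri y x x0; lra.
have X00 : enorm (x0 - x0) <= d by rewrite subrr enorm0 ltW.
have near y : [set y0; y1; y2; y3] y -> enorm (y - x0) <= d + d / 100.
  case; [case; [case|]|] => ->; [exact: (near0 _ _ X00 yx0)|exact: (near0 _ _ x1d yx1)
    |exact: (near0 _ _ x2d yx2)|exact: (near0 _ _ x3d yx3)].
apply: tetra_curvature_ge => // [x y /near xn /near yn|].
  by have := enorm_tri x x0 y; rewrite (enormC x0 y); lra.
have diff x y : enorm (y - x) <= k / 100 * d ->
    enorm ((y - y0) - (x - x0)) <= 2 * (k / 100 * d).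
  have -> : (y - y0) - (x - x0) = (y - x) - (y0 - x0).
    by rewrite !opprB addrACA [RHS]addrACA; congr (_ + _); rewrite addrC.
  by move=> yx; have := enormB (y - x) (y0 - x0); lra.
apply: le_trans (det3_perturb _ x1d x2d x3d (diff _ _ yx1) (diff _ _ yx2) (diff _ _ yx3)).
  have : 0 < k * d ^+ 3 by rewrite mulr_gt0// exprn_gt0.
  by move: detk; lra.
by apply/andP; split; lra.
Qed.

Lemma closed_enorm_ball x (r : R) : closed [set y | enorm (y - x) <= r].
Proof.
move=> y ycl; apply/ler_addgt0Pr => e e0.
have [|z [/= zr yz]] := ycl (ball y (e / 2)).
  by apply: nbhsx_ballx; rewrite divr_gt0.
have {}yz : `|y - z| < e / 2 by move: yz; rewrite mx_norm_ball.
have := enorm_tri y z x; have := enorm_le_mx_norm (y - z); lra.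
Qed.

Definition surface_ball S x (r : R) := S `&` [set y | enorm (y - x) <= r].

Lemma measurable_surface_ball S x r : closed S ->
  measurable (surface_ball S x r : set (caratheodory_type (@hausdorff2_outer R))).
Proof.
move=> clS; apply: closed_caratheodory; apply: closedI => //.
exact: closed_enorm_ball.
Qed.

(** A sequence that at least doubles is, up to a factor two, summed by its last
 term. *)
Lemma geometric_sum_le (N : nat) (q : nat -> R) (b : nat -> bool) (F : R) :
  0 <= F -> (forall n, 0 <= q n) -> (forall n, 2 * q n <= q n.+1) ->
  (forall n, b n -> 2 * q n <= F) -> \sum_(n < N) q n * (b n)%:R <= F.
Proof.
move=> F0 q0 q2 bF.
have prev n : \sum_(i < n) q i * (b i)%:R <= q n.
  elim: n => [|n IH]; first by rewrite big_ord0.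
  rewrite big_ord_recr /=; apply: le_trans (q2 n); have := q0 n.
  by case: (b n); rewrite ?mulr1 ?mulr0; move: IH; lra.
elim: N => [|N IH]; first by rewrite big_ord0.
rewrite big_ord_recr /=; case bN : (b N); rewrite ?mulr1 ?mulr0 ?addr0//.
by have := bF _ bN; have := prev N; lra.
Qed.

(** Fat tetrahedra of geometrically decreasing sizes contribute separately to
 the curvature integral, each of them by the same amount: the exponent 8 makes
 the contribution independent of the size. *)
Lemma menger_fat_family S k c (N : nat) (d : nat -> R) (x0 x1 x2 x3 : nat -> 'rV[R]_3) :
  closed S -> 0 < k <= 1 -> 0 <= c ->
  (forall n, 0 < d n) -> (forall n, d n.+1 <= d n / 2) ->
  (forall n, (n < N)%N -> fat_tetra k (d n) (x0 n) (x1 n) (x2 n) (x3 n)) ->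
  (forall n x, (n < N)%N -> [\/ x = x0 n, x = x1 n, x = x2 n | x = x3 n] ->
     ((c * (k / 100 * d n) ^+ 2)%:E <= hausdorff2 (surface_ball S x (k / 100 * d n)))%E) ->
  ((N%:R * ((k / 2000) ^+ 8 / 2 * (c * (k / 100) ^+ 2) ^+ 4))%:E
     <= integral_menger 8 S)%E.
Proof.
move=> clS k01 c0 d0 d2 fat; have /andP[k0 k1] := k01.
have := fun n nN => fat_tetra_curvature k01 (d0 n) (fat n nN).
have : 0 < k / 2000 := divr_gt0 k0 (ltr0Sn R 1999).
(* The two numerical factors are generalized to keep large numerals out of the
   arithmetic below. *)
move: (k / 2000) (k / 100) => K a K0 curv dens.
(* Half the lower bound for the integrand, as [geometric_sum_le] requires. *)
pose q n := (K / d n) ^+ 8 / 2.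
have p0 n : 0 <= K / d n by apply: divr_ge0; exact: ltW.
have q0 n : 0 <= q n by apply: divr_ge0 => //; exact: exprn_ge0.
have q2 n : 2 * q n <= q n.+1.
  have h : 2 * (K / d n) <= K / d n.+1.
    have -> : 2 * (K / d n) = K * (2 / d n) by rewrite mulrCA.
    apply: (ler_wpM2l (ltW K0)); rewrite ler_pdivrMr// mulrC ler_pdivlMr//.
    by have := d2 n; lra.
  have := lerXn2r 8 (mulr_ge0 (ler0n R 2) (p0 n)) (p0 n.+1) h.
  rewrite exprMn /q; have := exprn_ge0 8 (p0 n).
  have -> : 2 ^+ 8 = 256 :> R by rewrite -natrX.
  lra.
pose A (xs : nat -> 'rV[R]_3) (i : 'I_N) : set (caratheodory_type (@hausdorff2_outer R)) :=
  surface_ball S (xs i) (a * d i).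
have mA xs i : measurable (A xs i) by exact: measurable_surface_ball.
have AS xs i : A xs i `<=` S by move=> y [].
have := @iterated_integral_ge_sum _ (caratheodory_type (@hausdorff2_outer R)) R (@H2 R) S N
  (A x0) (A x1) (A x2) (A x3) (fun i => (q i)%:E)
  (fun y0 y1 y2 y3 => (tetra_curvature y0 y1 y2 y3 `^ 8)%:E).
move=> I8; apply: le_trans (I8 _ _ _ _) => // {I8}.
- have -> : (N%:R * (K ^+ 8 / 2 * (c * a ^+ 2) ^+ 4))%:E =
      (\sum_(i < N) (K ^+ 8 / 2 * (c * a ^+ 2) ^+ 4)%:E)%E.
    by rewrite sumEFin sumr_const card_ord mulr_natl.
  apply: lee_sum => i _.
  pose m := c * (a * d i) ^+ 2.
  have m0 : 0 <= m by rewrite mulr_ge0// sqr_ge0.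
  have -> : K ^+ 8 / 2 * (c * a ^+ 2) ^+ 4 = q i * m * m * m * m.
    by rewrite /q /m; field; rewrite gt_eqF.
  have prod (u v : R) (U V : \bar R) : 0 <= u -> 0 <= v ->
      (u%:E <= U -> v%:E <= V -> (u * v)%:E <= U * V)%E.
    by move=> u0 v0 uU vV; rewrite EFinM; apply: lee_pmul; rewrite ?lee_fin.
  have D (xs : nat -> 'rV[R]_3) : [\/ xs i = x0 i, xs i = x1 i, xs i = x2 i | xs i = x3 i] ->
    (m%:E <= @H2 R (A xs i))%E by exact: dens (ltn_ord i).
  have qm0 := mulr_ge0 (q0 i) m0; have qmm0 := mulr_ge0 qm0 m0.
  have h1 := prod _ _ _ _ (q0 i) m0 (lexx _) (D x0 (Or41 _ _ _ erefl)).
  have h2 := prod _ _ _ _ qm0 m0 h1 (D x1 (Or42 _ _ _ erefl)).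
  have h3 := prod _ _ _ _ qmm0 m0 h2 (D x2 (Or43 _ _ _ erefl)).
  exact: (prod _ _ _ _ (mulr_ge0 qmm0 m0) m0 h3 (D x3 (Or44 _ _ _ erefl))).
- by move=> i; rewrite lee_fin.
- move=> y0 y1 y2 y3 Sy0 Sy1 Sy2 Sy3.
  pose b n := [&& (n < N)%N, y3 \in surface_ball S (x3 n) (a * d n),
    y2 \in surface_ball S (x2 n) (a * d n), y1 \in surface_ball S (x1 n) (a * d n)
    & y0 \in surface_ball S (x0 n) (a * d n)].
  rewrite (eq_bigr (fun i : 'I_N => (q i * (b i)%:R)%:E)); last first.
    move=> i _; rewrite !indicE -!EFinM /b /A ltn_ord; congr _%:E.
    by do 4 case: (_ \in _) => //=; rewrite ?mulr0 ?mul0r ?mulr1.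
  rewrite sumEFin lee_fin; apply: geometric_sum_le => //; first exact: powR_ge0.
  move=> n /and5P[nN]; rewrite !inE => -[_ /= h3] [_ /= h2] [_ /= h1] [_ /= h0].
  have h := curv _ _ _ _ _ nN h0 h1 h2 h3.
  have p1 := le_trans (p0 n) h.
  rewrite powR_mulrn// /q; have := lerXn2r 8 (p0 n) p1 h; lra.
Qed.

End Curvature.

(** * Crossing the boundary of an open set *)

Section Crossing.
Context {R : realType}.
Implicit Types (U S : set 'rV[R]_3) (x y a b : 'rV[R]_3).

(** Otherwise [U] and its closure would cut the same set out of the segment, open and
 closed in it. *)
Lemma segment_crossing U a b : open U -> U a -> ~ U b ->
  exists2 t : R, 0 <= t <= 1 & boundary U (a + t *: (b - a)).
Proof.
move=> oU Ua nUb; apply: contrapT => ncross.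
pose g (t : R) : 'rV[R]_3 := a + t *: (b - a).
have cg : continuous g.
  move=> t; apply: cvgD; first exact: cvg_cst.
  by apply: cvgZr_tmp; exact: cvg_id.
have E : `[(0 : R), 1]%classic `&` (g @^-1` U) = `[(0 : R), 1]%classic.
  apply: (@segment_connected R 0 1).
  - by exists 0; split; rewrite /= ?in_itv /= ?lexx ?ler01// /g scale0r addr0.
  - by exists (g @^-1` U) => //; apply: open_comp => // t _; exact: cg.
  - exists (g @^-1` (closure U)).
      by apply: preimage_closed; [move=> t _; exact: cg|exact: closed_closure].
    apply/seteqP; split=> t [t01 Ut]; split=> //=; first exact: subset_closure.
    apply: contrapT => nUt; apply: ncross; exists t; first by move: t01; rewrite /= in_itv.
    by split=> //; rewrite ((interior_id U).1 oU).
have : (`[(0 : R), 1]%classic `&` (g @^-1` U)) 1.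
  by rewrite E /= in_itv /= ler01 lexx.
by move=> [_]; rewrite /= /g scale1r addrC subrK.
Qed.

Lemma boundary_open U x : open U -> boundary U x -> closure U x /\ ~ U x.
Proof. by move=> oU [Ux]; rewrite ((interior_id U).1 oU). Qed.

Lemma off_boundary U x : open U -> ~ boundary U x -> closure U x -> U x.
Proof.
by move=> oU nSx Ux; apply: contrapT => nUx; apply: nSx; split=> //; rewrite ((interior_id U).1 oU).
Qed.

Lemma closure_near U x (r : R) : 0 < r -> closure U x ->
  exists2 y, U y & enorm (y - x) < r.
Proof.
move=> r0 Ux; have [|y [Uy xy]] := Ux (ball x (r / 2)).
  by apply: nbhsx_ballx; rewrite divr_gt0.
exists y => //; move: xy; rewrite mx_norm_ball /ball_ /= => xy.
by have := enorm_le_mx_norm (x - y); rewrite enormC; lra.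
Qed.

Lemma nbhs_enorm x (r : R) : 0 < r -> nbhs x [set y | enorm (y - x) < r].
Proof.
move=> r0; apply/nbhs_ballP; exists (r / 2); first by rewrite /= divr_gt0.
move=> y; rewrite mx_norm_ball /ball_ /= => xy.
by have := enorm_le_mx_norm (x - y); rewrite enormC; lra.
Qed.

Lemma open_enorm U x : open U -> U x ->
  exists2 r : R, 0 < r & forall y, enorm (y - x) < r -> U y.
Proof.
rewrite openE => oU /oU /nbhs_ballP[r /= r0 rU]; exists r => // y yx; apply: rU.
rewrite mx_norm_ball /ball_ /= distrC; apply: le_lt_trans yx; exact: mx_norm_le_enorm.
Qed.

(** Chains of short steps join any two points of a connected set. *)
Lemma connected_spread S (r : R) (P : 'rV[R]_3 -> Prop) x : connected S -> 0 < r ->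
  (forall y z, S y -> S z -> enorm (z - y) < r -> P y -> P z) ->
  S x -> P x -> forall y, S y -> P y.
Proof.
move=> cS r0 step Sx Px y Sy.
have near_in (v z : 'rV[R]_3) : enorm (z - v) < r -> nbhs z [set w | enorm (w - v) < r].
  move=> zv; rewrite -subr_gt0 in zv.
  move: (nbhs_enorm z zv); apply: filterS => w /= wz.
  by have := enorm_tri w z v; lra.
pose N (Q : set 'rV[R]_3) := [set z | exists2 y, S y /\ Q y & enorm (z - y) < r].
have oN Q : open (N Q).
  rewrite openE => z [w SQw zw]; move: (near_in _ _ zw); apply: filterS => v vw.
  by exists w.
have self (z : 'rV[R]_3) : enorm (z - z) < r by rewrite subrr enorm0.
suff E : S `&` P = S by have : (S `&` P) y by [rewrite E]; case.
apply: cS; first by exists x.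
- exists (N P) => //; apply/seteqP; split=> z [Sz]; first by move=> Pz; split=> //; exists z.
  by move=> [w [Sw Pw] zw]; split=> //; exact: (step w).
- exists (~` N (~` P)); first exact: open_closedC.
  apply/seteqP; split=> z [Sz].
    by move=> Pz; split=> // -[w [Sw nPw] zw]; apply: nPw; apply: (step z) => //; rewrite enormC.
  by move=> nN; split=> //; apply: contrapT => nPz; apply: nN; exists z.
Qed.

(** Otherwise the closure of [U] would be open, and a segment leaving the bounded
 set [U] would have nowhere to cross its boundary. *)
Lemma two_sided_point U : open U -> U !=set0 -> bounded_set U ->
  exists2 x, closure U x & closure (~` closure U) x.
Proof.
move=> oU [a Ua] bU; apply: contrapT => nx.
have openC : open (closure U).
  rewrite -[closure U]setCK; apply: closed_openC.
  move=> x Vx Ux; apply: nx; by exists x.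
have [M [_ MP]] := bU.
have M1 : M < `|M| + 1 by have := ler_norm M; lra.
have UM x : closure U x -> enorm x <= 2 * (`|M| + 1) + 1.
  move=> /(closure_near ltr01)[y Uy yx].
  have /= := MP _ M1 y Uy; have := enorm_le_mx_norm y.
  by have := enorm_tri x y 0; rewrite !subr0 (enormC x y); lra.
pose b : 'rV[R]_3 := vec3 (2 * (`|M| + 1) + 2) 0 0.
have b0 : 0 <= 2 * (`|M| + 1) + 2 by have := normr_ge0 M; lra.
have nb : ~ closure U b.
  move/UM; rewrite /enorm dot3E !vec3E !mulr0 !addr0 -expr2 sqrtr_sqr ger0_norm//; lra.
have [t _] := segment_crossing openC (subset_closure Ua) nb.
case; rewrite ((interior_id _).1 openC).
by move=> CCy nCy; apply: nCy; exact: (@closed_closure _ U).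
Qed.

End Crossing.

(** * Lipschitz graphs *)

Section LocalGraph.
Context {R : realType}.
Implicit Types (S : set 'rV[R]_3) (x y e : 'rV[R]_3) (G : 'rV[R]_3 -> R).

(** Near [x] the surface is the zero set of a Lipschitz function of slope one in
 the direction [e]. *)
Definition graph_near S x e G (L rho : R) : Prop :=
  [/\ dot e e = 1, (forall y y', `|G y - G y'| <= L * enorm (y - y')),
      (forall y z, G (y + z *: e) = G y + z)
    & forall y, enorm (y - x) < rho -> S y <-> G y = 0].

(** In the coordinates of the rigid motion [phi], take for [G] the third coordinate
 minus the height of the graph; [e] is the vector sent to the third axis. *)
Lemma graph_nearP S x : locally_lipschitz_graph S -> S x ->
  exists e G (L rho : R), [/\ 0 <= L, 0 < rho & graph_near S x e G L rho].
Proof.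
move=> lS Sx; have [W [phi [f [[oW Wx] [Q [b [QQ phiE]]] lipf SW]]]] := lS _ Sx.
have QTQ : Q^T *m Q = 1%:M by apply: mulmx1C.
have enormQ (u : 'rV[R]_3) : enorm (u *m Q) = enorm u.
  have dotM (v w : 'rV[R]_3) : dot v w = (v *m w^T) 0 0.
    by rewrite mxE; apply: eq_bigr => i _; rewrite mxE.
  by rewrite /enorm !dotM trmx_mul mulmxA -(mulmxA u) QQ mulmx1.
pose e : 'rV[R]_3 := row 2 Q^T.
have eQ : e *m Q = row 2 1%:M by rewrite -row_mul QTQ.
pose base (p : 'rV[R]_3) : 'rV[R]_2 := lsubmx (p : 'rV[R]_(2 + 1)).
have [M [_ MP]] := lipf.
have M1 : M < `|M| + 1 by have := ler_norm M; lra.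
have {}lipf u v : `|f u - f v| <= (`|M| + 1) * `|u - v|.
  exact: (MP _ M1 (u, v) (conj I I)).
have baseB p p' : base (p - p') = base p - base p' by apply/rowP => i; rewrite !mxE.
have base_le p : `|base p| <= enorm p.
  apply: le_trans (mx_norm_le_enorm _).
  rewrite [leLHS]/Num.Def.normr/= mx_normrE; apply: bigmax_le => //= -[i j] _ /=.
  rewrite mxE [leRHS]/Num.Def.normr/= mx_normrE; apply/bigmax_geP; right => /=.
  by exists (i, lshift 1 j).
pose G y : R := phi y 0 2 - f (base (phi y)).
have [rho rho0 rhoW] := open_enorm oW Wx.
have L0 : 0 <= `|M| + 2 by rewrite addr_ge0.
exists e, G, (`|M| + 2), rho; split=> //.
split.
- by rewrite -enorm2 -(enormQ e) eQ enorm2 dot3E !mxE /=; ring.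
- move=> y y'.
  have phiB : phi y - phi y' = (y - y') *m Q by rewrite phiE mulmxBl opprD addrACA subrr addr0.
  have h1 : `|phi y 0 2 - phi y' 0 2| <= enorm (y - y').
    apply: le_trans (_ : `|phi y - phi y'| <= _); last first.
      by rewrite phiB -(enormQ (y - y')); exact: mx_norm_le_enorm.
    rewrite [leRHS]/Num.Def.normr/= mx_normrE; apply/bigmax_geP; right => /=.
    by exists (0, 2) => //=; rewrite !mxE.
  have h2 : `|f (base (phi y)) - f (base (phi y'))| <= (`|M| + 1) * enorm (y - y').
    apply: le_trans (lipf _ _) _; apply: ler_wpM2l; first by rewrite addr_ge0.
    by rewrite -baseB phiB -(enormQ (y - y')).
  have -> : G y - G y' = (phi y 0 2 - phi y' 0 2) - (f (base (phi y)) - f (base (phi y'))).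
    by rewrite /G; ring.
  by apply: le_trans (ler_normB _ _) _; lra.
- move=> y z.
  have phiz : phi (y + z *: e) = phi y + z *: row 2 1%:M.
    by rewrite phiE mulmxDl -scalemxAl eQ addrAC.
  have -> : G (y + z *: e) = phi (y + z *: e) 0 2 - f (base (phi (y + z *: e))) by [].
  have -> : base (phi (y + z *: e)) = base (phi y).
    rewrite phiz; apply/rowP => i; rewrite !mxE.
    have -> : (2 == lshift 1 i :> 'I_3) = false.
      by apply/eqP => /(congr1 val) /= i2; have := ltn_ord i; rewrite -i2.
    by rewrite mulr0n mulr0 addr0.
  by rewrite phiz !mxE eqxx mulr1n mulr1 /G addrAC.
- move=> y yx; have Wy := rhoW _ yx.
  have -> : S y <-> graph2 f (phi y).
    have : (S `&` W) y <-> (phi @^-1` graph2 f `&` W) y by rewrite SW.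
    by move=> [h1 h2]; split=> [Sy|gy]; [case: h1|case: h2].
  have phi_split : phi y = row_mx (base (phi y)) (phi y 0 2)%:M :> 'rV[R]_(2 + 1).
    rewrite -[LHS](@hsubmxK _ 1 2 1); congr row_mx; apply/rowP => i; rewrite !mxE [i]ord1.
    by rewrite mulr1n; congr (phi y 0 _); apply: val_inj.
  split=> [[u _ uy]|/subr0_eq Gy].
    have bu : base (phi y) = u by rewrite -uy /base row_mxKl.
    have := congr1 (fun p : 'rV[R]_(2 + 1) => rsubmx p 0 0) uy.
    rewrite row_mxKr !mxE mulr1n => fu; rewrite /G bu fu.
    by apply/eqP; rewrite subr_eq0; apply/eqP; congr (phi y 0 _); apply: val_inj.
  by exists (base (phi y)) => //; rewrite [RHS]phi_split Gy.
Qed.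

(** The part of the graph over a square of side comparable to [r], projected along [e]. *)
Lemma graph_near_density S x e G (L rho : R) : 0 <= L -> graph_near S x e G L rho ->
  forall y r, S y -> enorm (y - x) < rho / 2 -> 0 < r < rho / 2 ->
  ((pi / 4 * (r / (2 * (L + 1))) ^+ 2)%:E <= hausdorff2 (surface_ball S y r))%E.
Proof.
move=> L0 [e1 GL Gz SG] y r Sy yx /andP[r0 rrho].
have [a [b [a1 b1 ab ae be]]] := orthonormal_pair e1.
set l := r / (2 * (L + 1)).
have L1 : 0 < L + 1 by lra.
have l0 : 0 <= l by rewrite divr_ge0 ?mulr_ge0// ltW.
have lr : 2 * (L + 1) * l = r by rewrite /l; field; rewrite gt_eqF.
have Gy : G y = 0 by apply/SG => //; lra.
apply: (hausdorff2_projection (x := y) l0 a1 b1) => s t sl tl.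
set u := s *: a + t *: b; set z := - G (y + u).
have ul : enorm u <= 2 * l.
  by apply: le_trans (enormD _ _) _; rewrite !enormZ (enorm1 a1) (enorm1 b1); lra.
have zl : `|z| <= L * (2 * l).
  rewrite /z normrN; have := GL (y + u) y; rewrite Gy subr0 [y + u]addrC addrK => h.
  by apply: le_trans h _; apply: ler_wpM2l.
have shift : y + u + z *: e - y = u + z *: e by rewrite -[y + u + _]addrA [y + _]addrC addrK.
have dist : enorm (y + u + z *: e - y) <= r.
  rewrite shift; apply: le_trans (enormD _ _) _.
  by rewrite enormZ (enorm1 e1) mulr1 -lr; lra.
exists (y + u + z *: e).
  split=> //; apply/SG; last by rewrite Gz /z subrr.
  by have := enorm_tri (y + u + z *: e) y x; lra.
rewrite shift /u !dotE a1 b1 ab (dotC b a) ab ae be.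
by split; ring.
Qed.

(** The constants of [graph_near_density] depend on the Lipschitz constants, but by
 compactness a single one serves all points. *)
Lemma surface_density S : compact S -> locally_lipschitz_graph S ->
  exists2 c : R, 0 < c & forall x r, S x -> 0 < r <= c ->
    ((c * r ^+ 2)%:E <= hausdorff2 (surface_ball S x r))%E.
Proof.
move=> cS lS.
pose P (c : R) (x : 'rV[R]_3) := S x -> forall r, 0 < r <= c ->
    ((c * r ^+ 2)%:E <= hausdorff2 (surface_ball S x r))%E.
have : \forall c \near 0^'+, S `<=` P c.
  apply: (iffLR (compact_near_coveringP S) cS R _ P) => x Sx.
  have [e [G [L [rho [L0 rho0 Gn]]]]] := graph_nearP lS Sx.
  have L1 : 0 < L + 1 by lra.
  pose c0 : R := pi / 4 / (2 * (L + 1)) ^+ 2.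
  have c00 : 0 < c0 by rewrite !divr_gt0 ?pi_gt0// exprn_gt0// mulr_gt0.
  have rho2 : 0 < rho / 2 by rewrite divr_gt0.
  exists ([set y | enorm (y - x) < rho / 2], [set c | 0 < c /\ c < Num.min c0 (rho / 2)]).
    split; first exact: nbhs_enorm.
    have m0 : 0 < Num.min c0 (rho / 2) by rewrite lt_min c00.
    by near=> c; split; near: c; [exact: nbhs_right_gt|exact: nbhs_right_lt].
  move=> [y c] [/= yx [cgt0]]; rewrite lt_min => /andP[cc0 crho] Sy r /andP[r0 rc].
  have rr : 0 < r < rho / 2 by rewrite r0 (le_lt_trans rc).
  apply: le_trans (graph_near_density L0 Gn Sy yx rr).
  rewrite lee_fin; apply: (@le_trans _ _ (c0 * r ^+ 2)).
    by rewrite ler_wpM2r ?sqr_ge0// ltW.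
  by rewrite le_eqVlt; apply/orP; left; apply/eqP; rewrite /c0; field; rewrite gt_eqF.
move=> cP; have [c [c0 Pc]] : exists c, 0 < c /\ S `<=` P c.
  by apply: (@filter_ex _ (0 : R)^'+); near=> c; split; near: c => //; exact: nbhs_right_gt.
by exists c => // x r Sx; exact: Pc.
Unshelve. all: by end_near. Qed.

End LocalGraph.

(** * Flatness and separation *)

Section Separation.
Context {R : realType}.
Variables (U : set 'rV[R]_3) (eps : R).
Hypotheses (openU : open U) (eps_gt0 : 0 < eps) (eps_le : 1000 * eps <= 1).
Implicit Types (x y z u nu : 'rV[R]_3) (d r : R).
Let S := boundary U.

Definition flat x d nu : Prop := dot nu nu = 1 /\
  forall y, S y -> enorm (y - x) <= d -> `|dot nu (y - x)| <= eps * d.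

(** The two caps of the ball cut off by the slab lie on different sides of the
 boundary; in particular the boundary is in the slab. *)
Definition separated x d nu : Prop := dot nu nu = 1 /\
  forall y, enorm (y - x) < d ->
    (eps * d < dot nu (y - x) -> U y) /\
    (dot nu (y - x) < - (eps * d) -> ~ closure U y).

Lemma flatN x d nu : flat x d nu -> flat x d (- nu).
Proof.
move=> [nu1 F]; split=> [|y Sy yx]; first by rewrite dotNl dotNr opprK.
by rewrite dotNl normrN; exact: F.
Qed.

(** A cap is convex and does not meet the boundary. *)
Lemma cap_connected y d nu p z : flat y d nu -> U p ->
  enorm (p - y) <= d -> enorm (z - y) <= d ->
  eps * d < dot nu (p - y) -> eps * d < dot nu (z - y) -> U z.
Proof.
move=> [nu1 F] Up pd zd pcap zcap; apply: contrapT => nUz.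
have [t /andP[t0 t1] Sm] := segment_crossing openU Up nUz.
have mE : p + t *: (z - p) - y = (1 - t) *: (p - y) + t *: (z - y).
  by apply/rowP => i; rewrite !mxE; ring.
have t1' : 0 <= 1 - t by rewrite subr_ge0.
have /(_ Sm) := F (p + t *: (z - p)).
rewrite mE => Fm; have := Fm (_ : _ <= _); rewrite !dotE => {}Fm.
have : `|(1 - t) * (dot nu p - dot nu y) + t * (dot nu z - dot nu y)| <= eps * d.
  apply: Fm; apply: le_trans (enormD _ _) _; rewrite !enormZ !ger0_norm//.
  have := ler_wpM2l t1' pd; have := ler_wpM2l t0 zd; lra.
rewrite !dotE in pcap zcap => /(le_trans (ler_norm _)).
have [t_half|t_half] := leP t 2^-1.
  have t1'' : 0 < 1 - t by lra.
  have := pcap; rewrite -(ltr_pM2l t1''); have := ler_wpM2l t0 (ltW zcap); lra.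
have t0' : 0 < t by lra.
have := zcap; rewrite -(ltr_pM2l t0'); have := ler_wpM2l t1' (ltW pcap); lra.
Qed.

Lemma separated_flat x d nu y : separated x d nu -> S y -> enorm (y - x) < d ->
  `|dot nu (y - x)| <= eps * d.
Proof.
move=> [_ sep] /(boundary_open openU)[Cy nUy] yx; have [up down] := sep _ yx.
rewrite ler_norml; apply/andP; split; rewrite leNgt; apply/negP => h.
  exact: down Cy.
by apply: nUy; exact: up.
Qed.

(** Perpendiculars to the slab run from [U] to its complement, so the boundary
 projects onto a full disc. *)
Lemma separated_section x d nu u : 0 < d -> separated x d nu ->
  dot nu u = 0 -> enorm u <= d / 2 ->
  exists2 t, `|t| <= eps * d & S (x + u + t *: nu).
Proof.
move=> d0 sep nuu ud; have [nu1 side] := sep.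
have ed0 : 0 < eps * d by rewrite mulr_gt0.
have ed1 : 1000 * (eps * d) <= d by rewrite mulrA -[leRHS]mul1r ler_wpM2r// ltW.
have shift t : x + u + t *: nu - x = u + t *: nu by rewrite -[x + u + _]addrA [x + _]addrC addrK.
have dist t : `|t| <= 2 * (eps * d) -> enorm (x + u + t *: nu - x) < d.
  move=> td; rewrite shift; have := enormD u (t *: nu).
  by rewrite enormZ (enorm1 nu1) mulr1; lra.
have height t : dot nu (x + u + t *: nu - x) = t.
  by rewrite shift dotDr dotZr nuu nu1; ring.
pose h := 2 * (eps * d).
have hh : `|h| <= 2 * (eps * d) by rewrite ger0_norm// /h; lra.
have Ua : U (x + u + h *: nu) by apply: (side _ (dist _ hh)).1; rewrite height /h; lra.
have nUb : ~ U (x + u + (- h) *: nu).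
  have nh : `|- h| <= 2 * (eps * d) by rewrite normrN.
  by move/subset_closure; apply: (side _ (dist _ nh)).2; rewrite height /h; lra.
have [s /andP[s0 s1]] := segment_crossing openU Ua nUb.
have -> : x + u + h *: nu + s *: (x + u + - h *: nu - (x + u + h *: nu)) =
    x + u + (h - 2 * s * h) *: nu by apply/rowP => i; rewrite !mxE; ring.
move=> Sm; exists (h - 2 * s * h) => //.
have sh : `|h - 2 * s * h| <= 2 * (eps * d).
  have := mulr_ge0 s0 (ltW ed0); have := ler_wpM2r (ltW ed0) s1.
  by rewrite ler_norml /h => h1 h2; apply/andP; split; lra.
by have := separated_flat sep Sm (dist _ sh); rewrite height.
Qed.

(** The disc of [separated_section] contains a square of side [d / 2]. *)
Lemma separated_density x d nu : 0 < d -> separated x d nu ->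
  ((pi / 4 * (d / 4) ^+ 2)%:E <= hausdorff2 (surface_ball S x d))%E.
Proof.
move=> d0 sep; have [nu1 _] := sep.
have ed1 : 1000 * (eps * d) <= d by rewrite mulrA -[leRHS]mul1r ler_wpM2r// ltW.
have [a [b [a1 b1 ab anu bnu]]] := orthonormal_pair nu1.
apply: (hausdorff2_projection (x := x) _ a1 b1) => [|s t sd td].
  by rewrite divr_ge0// ltW.
set u := s *: a + t *: b.
have nuu : dot nu u = 0 by rewrite /u !dotE (dotC nu a) (dotC nu b) anu bnu; ring.
have ud : enorm u <= d / 2.
  by apply: le_trans (enormD _ _) _; rewrite !enormZ (enorm1 a1) (enorm1 b1); lra.
have [z zd Sz] := separated_section d0 sep nuu ud.
have shift : x + u + z *: nu - x = u + z *: nu by rewrite -[x + u + _]addrA [x + _]addrC addrK.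
exists (x + u + z *: nu).
  split=> //=; rewrite shift; apply: le_trans (enormD _ _) _.
  by rewrite enormZ (enorm1 nu1) mulr1; lra.
by rewrite shift /u !dotE a1 b1 ab (dotC b a) ab anu bnu; split; ring.
Qed.

(** The full disc seen by the first slab forces any other slab of comparable
 size to be nearly parallel to it; each cap of the second slab then contains a
 point of the corresponding cap of the first one. *)
Lemma separated_transfer x d nu y d' nu' : 0 < d -> separated x d nu ->
  S y -> enorm (y - x) < d / 8 -> d / 4 <= d' <= 2 * d -> flat y d' nu' ->
  exists nu'', separated y d' nu''.
Proof.
move=> d0 sep Sy yx /andP[dd' d'd] flat'; have [nu1 side] := sep; have [nu1' F'] := flat'.
have ed0 : 0 < eps * d by rewrite mulr_gt0.
have ed1 : 1000 * (eps * d) <= d by rewrite mulrA -[leRHS]mul1r ler_wpM2r// ltW.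
have ed'0 : 0 < eps * d' by rewrite mulr_gt0//; lra.
have ed' : eps * d' <= 2 * (eps * d) by rewrite mulrCA ler_wpM2l// ltW.
set t0 := dot nu (y - x); set u0 := y - x - t0 *: nu.
have t0d : `|t0| <= eps * d by apply: (separated_flat sep Sy); lra.
set c := dot nu nu'; set w := nu' - c *: nu.
have nuw : dot nu w = 0 by rewrite /w !dotE nu1 /c; ring.
have nu'w : dot nu' w = enorm w ^+ 2.
  by rewrite enorm2 /w !dotE nu1 nu1' /c (dotC nu' nu); ring.
have c1 : `|c| <= 1 by rewrite -(enorm1 nu1') dot_unit_le.
have cw : c ^+ 2 = 1 - enorm w ^+ 2.
  by rewrite enorm2 /w !dotE nu1 nu1' /c (dotC nu' nu); ring.
have w_le : enorm w <= 64 * eps.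
  have [->|w0] := eqVneq w 0; first by rewrite enorm0 mulr_ge0// ltW.
  have nw0 := enorm_gt0 w0.
  (* Moving by [d / 16] along the part of [nu'] orthogonal to [nu] keeps close to the
     boundary, but changes the height above the second slab by [d / 16 * enorm w]. *)
  set u := (d / 16 / enorm w) *: w.
  have uE : enorm u = d / 16.
    by rewrite enormZ ger0_norm ?divr_ge0 ?ltW// divfK// gt_eqF.
  have [||t td Sz] := @separated_section x d nu (u0 + u) d0 sep.
  - by rewrite dotDr /u dotZr nuw /u0 !dotE nu1 /t0 !dotE; ring.
  - have := enormD u0 u; have := enormB (y - x) (t0 *: nu).
    by rewrite -/u0 enormZ (enorm1 nu1) uE; lra.
  have zy : x + (u0 + u) + t *: nu - y = u + (t - t0) *: nu.
    by apply/rowP => i; rewrite /u0 !mxE; ring.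
  have tt0 : `|t - t0| <= 2 * (eps * d) by have := ler_normB t t0; lra.
  have := F' _ Sz; rewrite zy => /(_ _)h.
  have : `|dot nu' (u + (t - t0) *: nu)| <= eps * d'.
    apply: h; apply: le_trans (enormD _ _) _.
    by rewrite uE enormZ (enorm1 nu1); lra.
  rewrite dotDr !dotZr nu'w (dotC nu' nu) -/c.
  have -> : d / 16 / enorm w * enorm w ^+ 2 = d / 16 * enorm w by field; rewrite gt_eqF.
  move=> /(le_trans (ler_norm _)).
  have : `|(t - t0) * c| <= 2 * (eps * d).
    by rewrite normrM -[leRHS]mulr1 ler_pM.
  have := ler_norm (- ((t - t0) * c)); rewrite normrN => h1 h2 h3.
  have : d * enorm w <= d * (64 * eps) by lra.
  by rewrite ler_pM2l.
have [nu2 [flat2 c2]] : exists nu2, flat y d' nu2 /\ 1 / 2 <= dot nu nu2.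
  have w1 : enorm w <= 1 / 2 by move: eps_le w_le; lra.
  have c2 : (1 / 2) ^+ 2 <= c ^+ 2.
    have := ler_pM (enorm_ge0 w) (enorm_ge0 w) w1 w1; rewrite -!expr2 cw; lra.
  have {}c2 : 1 / 2 <= `|c| by rewrite -(@ler_pXn2r _ 2) ?nnegrE ?divr_ge0// real_normK ?num_real.
  have [c0|c0] := leP 0 c.
    by exists nu'; split=> //; rewrite -/c -(ger0_norm c0).
  by exists (- nu'); split; [exact: flatN|rewrite dotNr -/c -ltr0_norm].
have [nu2_1 F2] := flat2; exists nu2; split=> // z zy.
have pole (s : R) : `|s| = d / 8 ->
    enorm (y + s *: nu - y) <= d' /\ enorm (y + s *: nu - x) < d.
  move=> sd; split; first by rewrite addrAC subrr add0r enormZ (enorm1 nu1) sd; lra.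
  have := enormD (y - x) (s *: nu); rewrite enormZ (enorm1 nu1) sd addrAC; lra.
have d8 : `|d / 8| = d / 8 by rewrite ger0_norm// divr_ge0// ltW.
have [pd px] := pole (d / 8) d8.
have nd8 : `|- (d / 8)| = d / 8 by rewrite normrN.
have [qd qx] := pole (- (d / 8)) nd8.
have height s : dot nu (y + s *: nu - x) = t0 + s.
  by rewrite addrAC dotDr dotZr nu1 mulr1.
have height2 s : dot nu2 (y + s *: nu - y) = s * dot nu nu2.
  by rewrite addrAC subrr add0r dotZr dotC.
have := t0d; rewrite ler_norml => /andP[t0m t0p].
have Up : U (y + (d / 8) *: nu) by apply: (side _ px).1; rewrite height; lra.
have nUq : ~ closure U (y + (- (d / 8)) *: nu) by apply: (side _ qx).2; rewrite height; lra.
have dc := ler_wpM2l (ltW d0) c2.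
split=> zcap.
  apply: (cap_connected flat2 Up pd (ltW zy)) => //.
  by rewrite height2; lra.
move=> Cz; apply: nUq; apply: subset_closure.
have Uz : U z.
  apply: off_boundary => // Sz; have := F2 _ Sz (ltW zy).
  by rewrite ler_norml => /andP[]; lra.
apply: (cap_connected (flatN flat2) Uz (ltW zy) qd); rewrite dotNl ?height2; lra.
Qed.

(** Without fat tetrahedra the boundary is close to a plane through [x]: it is
 spanned by two vertices whose triangle is not too thin, or contains a long edge,
 or is arbitrary if there is no long edge. *)
Lemma no_fat_flat x d : 0 < d -> S x ->
  (forall x1 x2 x3, S x1 -> S x2 -> S x3 -> ~ fat_tetra (eps ^+ 4) d x x1 x2 x3) ->
  exists nu, flat x d nu.
Proof.
move=> d0 Sx nofat.
have e1 : eps <= 1 by move: eps_gt0 eps_le; lra.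
have ed0 : 0 < eps * d by rewrite mulr_gt0.
have det_lt x1 x2 x3 : S x1 -> S x2 -> S x3 -> enorm (x1 - x) <= d ->
    enorm (x2 - x) <= d -> enorm (x3 - x) <= d ->
    `|dot (cross (x1 - x) (x2 - x)) (x3 - x)| < eps ^+ 4 * d ^+ 3.
  move=> S1 S2 S3 h1 h2 h3; rewrite ltNge; apply/negP => h.
  exact: (nofat x1 x2 x3 S1 S2 S3).
have [[y1 [y2 [[S1 h1] [S2 h2] big]]]|thin] := pselect (exists y1 y2,
    [/\ S y1 /\ enorm (y1 - x) <= d, S y2 /\ enorm (y2 - x) <= d
      & eps ^+ 2 * d ^+ 2 <= enorm (cross (y1 - x) (y2 - x))]).
  set n := cross (y1 - x) (y2 - x) in big.
  have ed2 : 0 < eps ^+ 2 * d ^+ 2 by rewrite mulr_gt0 ?exprn_gt0.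
  have nn0 : 0 < enorm n by apply: lt_le_trans big.
  have n0 : n != 0 by apply/eqP => n0; rewrite n0 enorm0 ltxx in nn0.
  exists ((enorm n)^-1 *: n); split; first exact: normalize_unit.
  move=> y3 S3 h3; rewrite dotZl normrM ger0_norm ?invr_ge0// mulrC.
  rewrite ler_pdivrMr//; apply: le_trans (ltW (det_lt _ _ _ S1 S2 S3 h1 h2 h3)) _.
  have -> : eps ^+ 4 * d ^+ 3 = eps * (eps * d) * (eps ^+ 2 * d ^+ 2) by ring.
  apply: ler_pM => //; [by rewrite mulr_ge0// ltW|exact: ltW|].
  by rewrite ler_piMl// ltW.
have {}thin y1 y2 : S y1 -> S y2 -> enorm (y1 - x) <= d -> enorm (y2 - x) <= d ->
    enorm (cross (y1 - x) (y2 - x)) <= eps ^+ 2 * d ^+ 2.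
  move=> S1 S2 h1 h2; rewrite leNgt; apply/negP => h; apply: thin.
  by exists y1, y2; split=> //; exact: ltW.
have [[y1 [S1 h1 long]]|short] := pselect (exists y1,
    [/\ S y1, enorm (y1 - x) <= d & eps * d < enorm (y1 - x)]).
  have [nu nu1 pnu] := orthogonal_unit (y1 - x).
  exists nu; split=> // y2 S2 h2.
  have := bessel_cross (y2 - x) nu1 pnu; rewrite -!enorm2 -exprMn => h.
  have {}h : `|dot nu (y2 - x)| * enorm (y1 - x) <= enorm (cross (y1 - x) (y2 - x)).
    have := ler_wsqrtr h; rewrite !sqrtr_sqr normrM.
    by rewrite !(ger0_norm (enorm_ge0 _)).
  have long0 : 0 < enorm (y1 - x) by apply: lt_trans long.
  rewrite -(ler_pM2r long0); apply: le_trans h _.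
  apply: le_trans (thin _ _ S1 S2 h1 h2) _.
  have -> : eps ^+ 2 * d ^+ 2 = (eps * d) * (eps * d) by ring.
  by rewrite ler_pM2l// ltW.
have [nu nu1 _] := orthogonal_unit (0 : 'rV[R]_3).
exists nu; split=> // y Sy h; apply: le_trans (dot_unit_le _ nu1) _.
by rewrite leNgt; apply/negP => long; apply: short; exists y.
Qed.

(** As long as the boundary is flat, separation passes from a size to its double. *)
Lemma separated_climb x s r : 0 < s -> s <= r -> S x ->
  (forall d, s <= d <= r -> exists nu, flat x d nu) ->
  (exists nu, separated x s nu) -> exists nu, separated x r nu.
Proof.
move=> s0 sr Sx flats.
have step d d' : s <= d -> d <= d' <= 2 * d -> d' <= r ->
    (exists nu, separated x d nu) -> exists nu, separated x d' nu.
  move=> sd /andP[dd' d'd] d'r [nu sep].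
  have [|nu' flat'] := flats d'; first by rewrite d'r (le_trans sd).
  apply: (separated_transfer _ sep Sx _ _ flat'); first by lra.
    by rewrite subrr enorm0; lra.
  by rewrite d'd andbT; lra.
have [n rn] : exists n : nat, r <= 2 ^+ n * s.
  exists (Num.truncn (r / s)).+1.
  rewrite -ler_pdivrMr//; apply: le_trans (ltW (truncnS_gt _)) _.
  by rewrite -natrX ler_nat ltnW// ltn_expl.
suff climb k : forall d, s <= d <= r -> r <= 2 ^+ k * d ->
    (exists nu, separated x d nu) -> exists nu, separated x r nu.
  by apply: (climb n s) => //; rewrite lexx.
elim: k => [|k IH] d /andP[sd dr] rk sep.
  by rewrite expr0 mul1r in rk; apply: (step d) => //; rewrite dr; lra.
have [r2|r2] := leP r (2 * d); first by apply: (step d) => //; rewrite dr.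
apply: (IH (2 * d)); first by apply/andP; split; lra.
  by rewrite mulrA -exprSr.
by apply: (step d) => //; [apply/andP; split; lra|exact: ltW].
Qed.

(** Separation passes to points closer than [r / 8], hence along the connected
 boundary. *)
Lemma separated_everywhere x r : connected S -> 0 < r -> S x ->
  (forall y, S y -> exists nu, flat y r nu) ->
  (exists nu, separated x r nu) -> forall y, S y -> exists nu, separated y r nu.
Proof.
move=> cS r0 Sx flats.
apply: (@connected_spread R S (r / 8)) => //; first by rewrite divr_gt0.
move=> y z Sy Sz zy [nu sep]; have [nu' flat'] := flats z Sz.
by apply: (separated_transfer r0 sep Sz zy _ flat'); apply/andP; split; lra.
Qed.

(** The upper cap contains a point of [U] at distance [r / 2] from the centre. *)
Lemma separated_bounded x r nu (M : R) : (forall y, U y -> enorm y <= M) -> 0 < r ->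
  separated x r nu -> r <= 2 * (M + enorm x).
Proof.
move=> UM r0 [nu1 side].
have ed1 : 1000 * (eps * r) <= r by rewrite mulrA -[leRHS]mul1r ler_wpM2r// ltW.
have shift : x + (r / 2) *: nu - x = (r / 2) *: nu by rewrite addrAC subrr add0r.
have r2 : 0 <= r / 2 by rewrite divr_ge0// ltW.
have dist : enorm (x + (r / 2) *: nu - x) = r / 2.
  by rewrite shift enormZ (enorm1 nu1) mulr1 ger0_norm.
have Uy : U (x + (r / 2) *: nu).
  by apply: (side _ _).1; rewrite ?dist ?shift ?dotZr ?nu1; lra.
have := UM _ Uy; have := enormB (x + (r / 2) *: nu) x; rewrite dist; lra.
Qed.

End Separation.

(** * A separated ball of arbitrarily small radius *)

Section FlatSpot.
Context {R : realType}.
Variables (U : set 'rV[R]_3) (eps : R).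
Hypotheses (openU : open U) (eps_gt0 : 0 < eps) (eps_le : 1000 * eps <= 1).
Implicit Types (x y z e : 'rV[R]_3) (G : 'rV[R]_3 -> R).
Let S := boundary U.

Lemma segment_same_side a b : (forall t : R, 0 <= t <= 1 -> ~ S (a + t *: (b - a))) ->
  U a <-> U b.
Proof.
move=> nS; split=> [Ua|Ub]; apply: contrapT => nU.
  by have [t t01 St] := segment_crossing openU Ua nU; exact: (nS t).
have [t /andP[t0 t1] St] := segment_crossing openU Ub nU.
apply: (nS (1 - t)); first by apply/andP; split; lra.
by move: St; congr (S _); apply/rowP => i; rewrite !mxE; ring.
Qed.

Lemma graph_nearN x e G (L rho : R) : graph_near S x e G L rho ->
  graph_near S x (- e) (fun y => - G y) L rho.
Proof.
move=> [e1 GL Gz SG]; split.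
- by rewrite dotNl dotNr opprK.
- by move=> y y'; rewrite -opprD normrN.
- by move=> y z; rewrite scalerN -scaleNr Gz opprD opprK.
- move=> y yx; rewrite SG//; split=> [->|/eqP]; first by rewrite oppr0.
  by rewrite oppr_eq0 => /eqP.
Qed.

(** Points above the graph are joined, through a point high above [x], without
 meeting the graph. *)
Lemma graph_above x e G (L rho : R) : 0 <= L -> 0 < rho -> graph_near S x e G L rho ->
  G x = 0 -> exists Q : Prop, forall y, enorm (y - x) < rho / (4 * (L + 2)) ->
    0 < G y -> (U y <-> Q).
Proof.
move=> L0 rho0 [e1 GL Gz SG] Gx.
set d := rho / (4 * (L + 2)).
have L2 : 0 < L + 2 by lra.
have d0 : 0 < d by rewrite divr_gt0// mulr_gt0.
have drho : 4 * (L + 2) * d = rho by rewrite /d; field; rewrite gt_eqF.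
have Ld0 : 0 <= L * d by rewrite mulr_ge0// ltW.
pose T := (L + 1) * d.
have T0 : 0 < T by rewrite mulr_gt0//; lra.
exists (U (x + T *: e)) => y yx Gy.
have off z t : enorm (z - x) < d -> 0 <= t <= 1 -> 0 < G z + t * T -> ~ S (z + (t * T) *: e).
  move=> zx /andP[t0 t1] Gpos; rewrite SG.
    by rewrite Gz => E; rewrite E ltxx in Gpos.
  rewrite addrAC; apply: le_lt_trans (enormD _ _) _.
  rewrite enormZ (enorm1 e1) mulr1 (ger0_norm (mulr_ge0 t0 (ltW T0))).
  have := ler_wpM2r (ltW T0) t1; rewrite /T in drho *; lra.
suff [up over] : (U y <-> U (y + T *: e)) /\ (U (y + T *: e) <-> U (x + T *: e)).
  by split=> h; [exact: over.1 (up.1 h)|exact: up.2 (over.2 h)].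
split; apply: segment_same_side => t /andP[t0 t1].
  have -> : y + t *: (y + T *: e - y) = y + (t * T) *: e.
    by apply/rowP => i; rewrite !mxE; ring.
  by apply: off; rewrite ?t0// ltr_wpDr//; exact: mulr_ge0 t0 (ltW T0).
have -> : y + T *: e + t *: (x + T *: e - (y + T *: e)) =
    x + (1 - t) *: (y - x) + (1 * T) *: e.
  by apply/rowP => i; rewrite !mxE; ring.
have zx : enorm (x + (1 - t) *: (y - x) - x) < d.
  rewrite addrAC subrr add0r enormZ ger0_norm ?subr_ge0//.
  by apply: le_lt_trans yx; rewrite ler_piMl//; lra.
apply: off => //; first by rewrite ler01 lexx.
have := GL (x + (1 - t) *: (y - x)) x; rewrite Gx subr0 ler_norml => /andP[+ _].
have := ler_wpM2l L0 (ltW zx); rewrite /T; lra.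
Qed.

(** Both [U] and the exterior accumulate at [x], and each side of the graph belongs to
 one of them; the orientation is chosen so that [U] lies above. *)
Lemma two_sided_graph x : locally_lipschitz_graph S ->
  closure U x -> closure (~` closure U) x ->
  exists e G (L rho : R), [/\ 0 <= L, 0 < rho, graph_near S x e G L rho & G x = 0 /\
    forall y, enorm (y - x) < rho ->
      (0 < G y -> U y) /\ (G y < 0 -> ~ closure U y)].
Proof.
move=> lS Ux Vx.
have nUx : ~ U x.
  move=> oUx; have [r r0 rU] := open_enorm openU oUx.
  have [y nCy yx] := closure_near r0 Vx.
  by apply: nCy; apply: subset_closure; exact: rU.
have Sx : S x by split=> //; rewrite ((interior_id U).1 openU).
have [e [G [L [rho [L0 rho0 Gn]]]]] := graph_nearP lS Sx.
have GnN := graph_nearN Gn.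
have [e1 GL Gz SG] := Gn.
have Gx : G x = 0 by apply/SG => //; rewrite subrr enorm0.
have GNx : - G x = 0 by rewrite Gx oppr0.
have [Qup up] := graph_above L0 rho0 Gn Gx.
have [Qdown down] := graph_above L0 rho0 GnN GNx.
set d := rho / (4 * (L + 2)) in up down.
have L2 : 0 < L + 2 by lra.
have d0 : 0 < d by rewrite divr_gt0// mulr_gt0.
have drho : d <= rho.
  by rewrite ler_pdivrMr ?mulr_gt0// ler_peMr// ?ltW//; lra.
have shrink e' G' : graph_near S x e' G' L rho -> graph_near S x e' G' L d.
  by move=> [h1 h2 h3 h4]; split=> // y yx; apply: h4; exact: lt_le_trans drho.
have notS y : enorm (y - x) < d -> G y <> 0 -> ~ S y.
  by move=> yx Gy Sy; apply: Gy; apply/SG => //; exact: lt_le_trans drho.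
have [yU UyU yUx] := closure_near d0 Ux.
have [yV VyV yVx] := closure_near d0 Vx.
have GU : G yU <> 0.
  move=> GU0; have /(boundary_open openU)[_] : S yU; last by apply.
  by apply/SG => //; exact: lt_le_trans drho.
have GV : G yV <> 0.
  move=> GV0; have /(boundary_open openU)[+ _] : S yV; last by apply: VyV.
  by apply/SG => //; exact: lt_le_trans drho.
have out y : enorm (y - x) < d -> G y <> 0 -> ~ U y -> ~ closure U y.
  by move=> yx Gy nUy /(off_boundary openU (notS _ yx Gy)).
have [qu|nqu] := pselect Qup; have [qd|nqd] := pselect Qdown.
- exfalso; apply: VyV; apply: subset_closure.
  have [GV0|GV0|//] := ltgtP (G yV) 0.
    by apply/(down _ yVx) => //; rewrite oppr_gt0.
  by apply/(up _ yVx).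
- exists e, G, L, d; split=> //; first exact: shrink.
  split=> // y yx; split=> Gy; first exact/(up _ yx).
  apply: out => //; first by move=> Gy0; rewrite Gy0 ltxx in Gy.
  by move/(down _ yx); rewrite oppr_gt0 => /(_ Gy).
- exists (- e), (fun y => - G y), L, d; split=> //; first exact: shrink.
  split=> // y yx; split=> Gy; first exact/(down _ yx).
  rewrite oppr_lt0 in Gy.
  apply: out => //; first by move=> Gy0; rewrite Gy0 ltxx in Gy.
  by move/(up _ yx) => /(_ Gy).
- exfalso; have [GU0|GU0|//] := ltgtP (G yU) 0.
    by apply: nqd; apply/(down _ yUx) => //; rewrite oppr_gt0.
  by apply: nqu; apply/(up _ yUx).
Qed.

(** The arithmetic-geometric inequality for the length and [a]. *)
Lemma enorm_first_order (a : R) (th w : 'rV[R]_3) : 0 < a -> dot th th = 1 ->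
  enorm (a *: th + w) <= a + dot th w + enorm w ^+ 2 / (2 * a) :> R.
Proof.
move=> a0 th1; have X2 := enorm2 (a *: th + w).
rewrite -(ler_pM2l a0).
have -> : a * (a + dot th w + enorm w ^+ 2 / (2 * a)) =
    (enorm (a *: th + w) ^+ 2 + a ^+ 2) / 2.
  by rewrite X2 !dotE th1 (dotC w th) enorm2; field; rewrite gt_eqF.
have := sqr_ge0 (enorm (a *: th + w) - a); lra.
Qed.

(** Let [l] be almost the best local Lipschitz constant of [G], almost attained
 between [u] and [v]. Being [l]-Lipschitz from both ends forces [G] to be, near the
 midpoint, affine of slope [l] in the direction of [v - u], up to a relative error
 that does not depend on [l]: this is the differentiability of a Lipschitz function
 at a point where its Lipschitz constant is attained. *)
Lemma near_extremal_slope G (l a : R) (u v : 'rV[R]_3) : 0 < l -> 0 < a ->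
  enorm (v - u) = 2 * a -> (1 - eps ^+ 2 / 4) * l * (2 * a) < G v - G u ->
  let m := 2^-1 *: (u + v) in
  (forall z z', [\/ z = u, z = v | z = m] -> enorm (z' - m) < eps * a ->
    `|G z' - G z| <= l * enorm (z' - z)) ->
  forall w, enorm w < eps * a ->
  (eps * (eps * a) < dot ((2 * a)^-1 *: (v - u)) w -> G m < G (m + w)) /\
  (dot ((2 * a)^-1 *: (v - u)) w < - (eps * (eps * a)) -> G (m + w) < G m).
Proof.
move=> l0 a0 uva steep m lip w wh.
set th := (2 * a)^-1 *: (v - u).
have a2 : 0 < 2 * a by rewrite mulr_gt0.
have th1 : dot th th = 1.
  by rewrite /th dotZl dotZr -enorm2 uva; field; rewrite gt_eqF.
have ath : a *: th = 2^-1 *: (v - u).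
  by rewrite /th scalerA; congr (_ *: _); field; rewrite gt_eqF.
have mu : m - u = a *: th by rewrite ath /m; apply/rowP => i; rewrite !mxE; field.
have mv : m - v = - (a *: th) by rewrite ath /m; apply/rowP => i; rewrite !mxE; field.
have h0 : 0 < eps * a by rewrite mulr_gt0.
have lipw z : [\/ z = u, z = v | z = m] -> `|G (m + w) - G z| <= l * enorm (m + w - z).
  by move=> zz; apply: lip => //; rewrite addrC addKr.
have lipm z : [\/ z = u, z = v | z = m] -> `|G m - G z| <= l * enorm (m - z).
  by move=> zz; apply: lip => //; rewrite subrr enorm0.
have normu : enorm (m + w - u) <= a + dot th w + (eps * a) ^+ 2 / (2 * a).
  rewrite addrAC mu; apply: le_trans (enorm_first_order _ a0 th1) _.
  by rewrite lerD2l ler_pM2r ?invr_gt0// lerXn2r ?nnegrE// ltW.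
have normv : enorm (m + w - v) <= a - dot th w + (eps * a) ^+ 2 / (2 * a).
  rewrite addrAC mv -enormN opprD opprK.
  apply: le_trans (enorm_first_order (- w) a0 th1) _.
  by rewrite dotNr enormN lerD2l ler_pM2r ?invr_gt0// lerXn2r ?nnegrE// ltW.
have E : (eps * a) ^+ 2 / (2 * a) = eps * (eps * a) / 2 by field; rewrite gt_eqF.
rewrite E in normu normv.
have mua : enorm (m - u) = a by rewrite mu enormZ (enorm1 th1) mulr1 ger0_norm// ltW.
have mva : enorm (m - v) = a by rewrite mv enormN enormZ (enorm1 th1) mulr1 ger0_norm// ltW.
have := lipw u (Or31 _ _ erefl); have := lipw v (Or32 _ _ erefl).
have := lipm u (Or31 _ _ erefl); have := lipm v (Or32 _ _ erefl).
rewrite mua mva !ler_norml => /andP[mv1 mv2] /andP[mu1 mu2] /andP[wv1 wv2] /andP[wu1 wu2].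
have nu' := ler_wpM2l (ltW l0) normu; have nv' := ler_wpM2l (ltW l0) normv.
have steep' : 2 * (l * a) - eps * (eps * a) / 2 * l < G v - G u.
  by apply: le_lt_trans steep; rewrite le_eqVlt; apply/orP; left; apply/eqP; field.
split=> hw.
  have : l * (eps * (eps * a)) < l * dot th w by rewrite ltr_pM2l.
  lra.
have : l * dot th w < l * (- (eps * (eps * a))) by rewrite ltr_pM2l.
lra.
Qed.

(** The infimum of the Lipschitz constants of [G] on small balls is at least one, so
 that a ball can be chosen on which it is almost reached; a smaller ball then
 contains a pair of points with almost extremal slope. *)
Lemma separated_spot x (sigma : R) : locally_lipschitz_graph S ->
  closure U x -> closure (~` closure U) x -> 0 < sigma ->
  exists y r, [/\ S y, 0 < r < sigma & exists nu, separated U eps y r nu].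
Proof.
move=> lS Ux Vx sigma0.
have [e [G [L [rho [L0 rho0 [e1 GL Gz SG] [Gx side]]]]]] := two_sided_graph lS Ux Vx.
have eps1 : eps <= 1 / 1000 by move: eps_le; lra.
pose rho2 := Num.min sigma (rho / (L + 2)).
have L2 : 0 < L + 2 by lra.
have rho20 : 0 < rho2 by rewrite lt_min sigma0 divr_gt0.
have rho2L : rho2 * (L + 2) <= rho.
  by rewrite -ler_pdivlMr// ge_min lexx orbT.
pose lip l r := forall y y', enorm (y - x) < r -> enorm (y' - x) < r ->
  `|G y - G y'| <= l * enorm (y - y').
pose C := [set l | exists r, 0 < r <= rho2 /\ lip l r].
have C1 l : C l -> 1 <= l.
  move=> [r [/andP[r0 _] lipl]].
  have r2 : 0 < r / 2 by rewrite divr_gt0.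
  have xe : x + (r / 2) *: e - x = (r / 2) *: e by rewrite addrAC subrr add0r.
  have ne : enorm ((r / 2) *: e) = r / 2 by rewrite enormZ (enorm1 e1) mulr1 ger0_norm// ltW.
  have := lipl (x + (r / 2) *: e) x.
  rewrite xe ne subrr enorm0 Gz Gx add0r subr0 ger0_norm ?(ltW r2)// => h.
  have r2r : r / 2 < r by lra.
  by have := h r2r r0; rewrite -{1}[r / 2]mul1r ler_pM2r.
have CL : C L by exists rho2; split; [rewrite rho20 lexx|move=> y y' _ _; exact: GL].
have Cinf : has_inf C by split; [exists L|exists 1 => l /C1].
have inf1 : 1 <= inf C by apply: lb_le_inf; [exists L|move=> l /C1].
pose eta := eps ^+ 2 / 4.
have eta0 : 0 < eta by rewrite divr_gt0// exprn_gt0.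
have [l [r [/andP[r0 rrho2] lipl]] lC] := inf_adherent (mulr_gt0 (lt_le_trans ltr01 inf1) eta0) Cinf.
have l1 : 1 <= l by apply: C1; exists r; rewrite r0.
have l0 : 0 < l by lra.
have nC : ~ C ((1 - eta) * l).
  move=> Cl; have : inf C <= (1 - eta) * l by apply: ge_inf => //; exact: Cinf.2.
  have eta1 : eta < 1 by rewrite /eta; move: eps_gt0 eps1; nra.
  have e10 : 0 < 1 - eta by lra.
  have h : (1 - eta) * l < (1 - eta) * (inf C + inf C * eta) by rewrite ltr_pM2l.
  have := mulr_ge0 (le_trans ler01 inf1) (sqr_ge0 eta); lra.
have r2 : 0 < r / 2 by rewrite divr_gt0.
have [u [v [ux vx steep]]] : exists u v, [/\ enorm (u - x) < r / 2,
    enorm (v - x) < r / 2 & (1 - eta) * l * enorm (v - u) < G v - G u].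
  apply: contrapT => nuv; apply: nC; exists (r / 2); split; first by rewrite r2; lra.
  move=> y y' yr y'r; rewrite ler_norml; apply/andP; split; rewrite leNgt; apply/negP => h.
    by apply: nuv; exists y, y'; split=> //; rewrite enormC; lra.
  by apply: nuv; exists y', y; split=> //; lra.
pose a := enorm (v - u) / 2.
have a0 : 0 < a.
  rewrite divr_gt0// enorm_gt0//; apply/eqP => /subr0_eq uv.
  by move: steep; rewrite uv !subrr enorm0 mulr0 ltxx.
have uva : enorm (v - u) = 2 * a by rewrite /a; field.
have ar : a <= r / 2.
  by have := enorm_tri v x u; rewrite (enormC x u) /a; lra.
have ea0 : 0 < eps * a by rewrite mulr_gt0.
have ea : eps * a <= a / 1000 by rewrite mulrC ler_pM2l//; lra.
pose m := 2^-1 *: (u + v).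
have mx : enorm (m - x) < r / 2.
  have -> : m - x = 2^-1 *: ((u - x) + (v - x)).
    by rewrite /m; apply/rowP => i; rewrite !mxE; field.
  rewrite enormZ ger0_norm ?invr_ge0//; have := enormD (u - x) (v - x); lra.
rewrite uva in steep; have slope := near_extremal_slope l0 a0 uva steep.
have in_ball z : enorm (z - m) < eps * a -> enorm (z - x) < r.
  by move=> zm; have := enorm_tri z m x; lra.
(* Sliding the midpoint along [e] to the surface changes [G] by a constant only. *)
pose y := m + (- G m) *: e.
have Gm : `|G m| <= L * (r / 2).
  have := GL m x; rewrite Gx subr0 => h; apply: le_trans h _.
  by rewrite ler_wpM2l// ltW.
have Lr : (L + 2) * r <= rho.
  by apply: le_trans rho2L; rewrite mulrC ler_wpM2r// ltW.
have ball_y w : enorm w < eps * a -> enorm (y + w - x) < rho.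
  move=> wh; have -> : y + w - x = (m - x) + (- G m) *: e + w.
    by rewrite /y; apply/rowP => i; rewrite !mxE; ring.
  apply: le_lt_trans (enormD _ _) _; have := enormD (m - x) ((- G m) *: e).
  by rewrite enormZ (enorm1 e1) normrN mulr1; lra.
have GyE w : G (y + w) = G (m + w) - G m by rewrite /y addrAC Gz.
have yx : enorm (y - x) < rho by have := ball_y 0; rewrite enorm0 addr0; exact.
exists y, (eps * a); split.
- by apply/SG => //; rewrite -[y]addr0 GyE addr0 subrr.
- rewrite ea0 /=; apply: le_lt_trans ea _.
  have : rho2 <= sigma by rewrite ge_min lexx.
  lra.
exists ((2 * a)^-1 *: (v - u)); split.
  by rewrite dotZl dotZr -enorm2 uva; field; rewrite gt_eqF.
move=> z zy; have zE : z = y + (z - y) by rewrite addrC subrK.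
have zx : enorm (z - x) < rho by rewrite zE; exact: ball_y.
have lips : forall z z', [\/ z = u, z = v | z = m] -> enorm (z' - m) < eps * a ->
    `|G z' - G z| <= l * enorm (z' - z).
  move=> p p' pp p'm; apply: lipl; first exact: in_ball.
  have r2r : r / 2 < r by lra.
  by case: pp => ->; apply: lt_trans r2r.
have [upper lower] := slope lips (z - y) zy.
have Gzz : G z = G (m + (z - y)) - G m by rewrite -GyE -zE.
by split=> h; [apply: (side _ zx).1; rewrite Gzz subr_gt0; exact: upper
  |apply: (side _ zx).2; rewrite Gzz subr_lt0; exact: lower].
Qed.

End FlatSpot.

(** * The lower bound *)

Section LowerBound.
Context {R : realType}.
Variables (U : set 'rV[R]_3) (eps : R).
Hypotheses (openU : open U) (eps_gt0 : 0 < eps) (eps_le : 1000 * eps <= 1).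
Let S := boundary U.
Let k := eps ^+ 4.

Let has_fat (d : R) := exists x0 x1 x2 x3,
  [/\ S x0, S x1, S x2, S x3 & fat_tetra k d x0 x1 x2 x3].

Let k_bound : 0 < k <= 1.
Proof.
rewrite exprn_gt0//= exprn_ile1 ?ltW//.
by move: eps_gt0 eps_le; lra.
Qed.

(** Fat tetrahedra of arbitrarily small size make the energy infinite: along a
 sequence of sizes tending to zero each of them contributes the same amount. *)
Lemma menger_fat_at_all_scales (gamma : R) :
  compact S -> locally_lipschitz_graph S ->
  (forall r : R, 0 < r -> exists2 d, 0 < d < r & has_fat d) ->
  (gamma%:E <= integral_menger 8 S)%E.
Proof.
move=> cS lS small; have /andP[k0 k1] := k_bound.
have clS : closed S by apply: compact_closed cS; exact: norm_hausdorff.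
have [c c0 dens] := surface_density cS lS.
have /choice[f fP] : forall r : R, exists q : R * ('rV[R]_3 * 'rV[R]_3 * 'rV[R]_3 * 'rV[R]_3),
    0 < r -> let: (d, (x0, x1, x2, x3)) := q in
    0 < d < r /\ [/\ S x0, S x1, S x2, S x3 & fat_tetra k d x0 x1 x2 x3].
  move=> r; have [r0|_] := ltP 0 r; last by exists (0, (0, 0, 0, 0)).
  have [d dr [x0 [x1 [x2 [x3 fat]]]]] := small r r0.
  by exists (d, (x0, x1, x2, x3)).
pose q := fix q n := if n is n'.+1 then f ((q n').1 / 2) else f c.
have d_gt0 n : 0 < (q n).1.
  elim: n => [|n IH] /=.
    by have := fP c c0; case: (f c) => d [[[? ?] ?] ?] /= [/andP[]].
  have r0 : 0 < (q n).1 / 2 by rewrite divr_gt0.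
  by have := fP _ r0; case: (f _) => d [[[? ?] ?] ?] /= [/andP[]].
have d_half n : (q n.+1).1 <= (q n).1 / 2.
  have r0 : 0 < (q n).1 / 2 by rewrite divr_gt0.
  by have := fP _ r0; rewrite /=; case: (f _) => d [[[? ?] ?] ?] /= [/andP[_ /ltW]].
have d_lt n : (q n).1 < c.
  elim: n => [|n IH].
    by have := fP c c0; rewrite /=; case: (f c) => d [[[? ?] ?] ?] /= [/andP[]].
  by apply: le_lt_trans (d_half n) _; have := d_gt0 n; lra.
have fat n : let: (d, (x0, x1, x2, x3)) := q n in
    [/\ S x0, S x1, S x2, S x3 & fat_tetra k d x0 x1 x2 x3].
  case: n => [|n] /=.
    by have := fP c c0; case: (f c) => d [[[? ?] ?] ?] /= [].
  have r0 : 0 < (q n).1 / 2 by rewrite divr_gt0.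
  by have := fP _ r0; case: (f _) => d [[[? ?] ?] ?] /= [].
pose B : R := (k / 2000) ^+ 8 / 2 * (c * (k / 100) ^+ 2) ^+ 4.
have B0 : 0 < B.
  have k2 : 0 < k / 2000 := divr_gt0 k0 (ltr0Sn R 1999).
  have k3 : 0 < k / 100 := divr_gt0 k0 (ltr0Sn R 99).
  rewrite /B; move: (k / 2000) (k / 100) k2 k3 => K a K0 a0.
  by rewrite mulr_gt0 ?exprn_gt0 ?divr_gt0 ?mulr_gt0 ?exprn_gt0.
have [N NB] : exists N : nat, gamma <= N%:R * B.
  exists (Num.truncn (gamma / B)).+1; rewrite -ler_pdivrMr//.
  exact: ltW (truncnS_gt _).
apply: (@le_trans _ _ (N%:R * B)%:E); first by rewrite lee_fin.
apply: (@menger_fat_family R S k c N (fun n => (q n).1) (fun n => (q n).2.1.1.1)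
  (fun n => (q n).2.1.1.2) (fun n => (q n).2.1.2) (fun n => (q n).2.2)) => //.
- exact: ltW.
- by move=> n _; have := fat n; case: (q n) => d [[[? ?] ?] ?] [].
- move=> n x _ xx; apply: dens.
    by have := fat n; move: xx; case: (q n) => d [[[? ?] ?] ?] /= + [? ? ? ? _]; case=> ->.
  have dn := d_gt0 n; have dc := d_lt n.
  have kd : 0 < k / 100 * (q n).1 by rewrite mulr_gt0// divr_gt0.
  rewrite kd /=; apply: le_trans (ltW dc).
  by rewrite ler_piMl ?ltW//; lra.
Qed.

(** At the smallest size [d] of fat tetrahedra, up to a factor two, the boundary is
 flat at all smaller sizes, hence separating there: each vertex of a fat tetrahedron
 of size [d] sees an absolute proportion of area at the size [k / 100 * d]. *)
Lemma menger_lower_bound : bounded_domain U -> compact S -> connected S ->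
  locally_lipschitz_graph S ->
  (((k / 2000) ^+ 8 / 2 * (pi / 64 * (k / 100) ^+ 2) ^+ 4)%:E
     <= integral_menger 8 S)%E.
Proof.
move=> [U0 _ _ bU] cS coS lS; have /andP[k0 k1] := k_bound.
have clS : closed S by apply: compact_closed cS; exact: norm_hausdorff.
have [|/existsNP[r1 /not_implyP[r10 r1P]]] :=
  pselect (forall r : R, 0 < r -> exists2 d, 0 < d < r & has_fat d).
  exact: menger_fat_at_all_scales.
have flats y d : S y -> 0 < d -> ~ has_fat d -> exists nu, flat U eps y d nu.
  move=> Sy d0 nofat; apply: no_fat_flat => // x1 x2 x3 S1 S2 S3 fat.
  by apply: nofat; exists y, x1, x2, x3.
have [x Ux Vx] := two_sided_point openU U0 bU.
have spot sigma := separated_spot openU eps_gt0 eps_le lS Ux Vx (sigma := sigma).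
pose D := [set d : R | 0 < d /\ has_fat d].
have D0 : D !=set0.
  apply: contrapT => nD.
  have nofat d : 0 < d -> ~ has_fat d by move=> d0 fat; apply: nD; exists d.
  have [M [_ MP]] := bU.
  have M1 : M < `|M| + 1 by have := ler_norm M; lra.
  have UM y : U y -> enorm y <= 2 * (`|M| + 1).
    by move=> Uy; have /= := MP _ M1 y Uy; have := enorm_le_mx_norm y; lra.
  have [y [s [Sy /andP[s0 s1] sep]]] := spot 1 ltr01.
  pose r := 2 * (2 * (`|M| + 1) + enorm y) + 1.
  have sr : s <= r by rewrite /r; have := normr_ge0 M; have := enorm_ge0 y; lra.
  have flat_y d : s <= d <= r -> exists nu, flat U eps y d nu.
    move=> /andP[sd _]; have d0 : 0 < d by apply: lt_le_trans sd.
    by apply: flats => //; exact: nofat.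
  have [nu sep'] := separated_climb openU eps_gt0 eps_le s0 sr Sy flat_y sep.
  have r0 : 0 < r by apply: lt_le_trans sr.
  by have := separated_bounded eps_le UM r0 sep'; rewrite /r; lra.
have Dinf : has_inf D by split=> //; exists 0 => d [/ltW].
have r1_inf : r1 <= inf D.
  apply: lb_le_inf => // d [d0 fat]; rewrite leNgt; apply/negP => dr1.
  by apply: r1P; exists d; rewrite ?d0.
have inf0 : 0 < inf D by apply: lt_le_trans r1_inf.
have [d [d0 [x0 [x1 [x2 [x3 [S0 S1 S2 S3 fat]]]]]] dlt] := inf_adherent inf0 Dinf.
pose s := k / 100 * d.
have s0 : 0 < s by rewrite mulr_gt0// divr_gt0.
have s_inf : s < inf D.
  have : s <= 1 / 100 * d by rewrite ler_pM2r// ler_pM2r ?invr_gt0.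
  lra.
have nofat r : 0 < r -> r < inf D -> ~ has_fat r.
  move=> r0 rinf hf; have : inf D <= r by apply: ge_inf; [exact: Dinf.2|].
  by rewrite leNgt rinf.
have [y [r [Sy /andP[r0 rs] sep]]] := spot s s0.
have sep_s : exists nu, separated U eps y s nu.
  apply: (separated_climb openU eps_gt0 eps_le r0 (ltW rs) Sy _ sep) => t /andP[rt ts].
  have t0 : 0 < t by apply: lt_le_trans rt.
  by apply: flats => //; apply: nofat => //; exact: le_lt_trans s_inf.
have sep_all := separated_everywhere openU eps_gt0 eps_le coS s0 Sy
  (fun z Sz => flats z s Sz s0 (nofat _ s0 s_inf)) sep_s.
(* A single tetrahedron, at the head of a sequence of halving sizes. *)
pose d_ n := d / 2 ^+ n.
have := @menger_fat_family R S k (pi / 64) 1 d_ (fun=> x0) (fun=> x1) (fun=> x2) (fun=> x3).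
rewrite mul1r; apply=> //.
- by rewrite divr_ge0// pi_ge0.
- by move=> n; rewrite divr_gt0// exprn_gt0.
- by move=> n; rewrite /d_ exprSr invfM mulrA.
- by move=> [|//] _; rewrite /d_ expr0 divr1.
- move=> [|//] z _ zz; rewrite /d_ expr0 divr1 -/s.
  have Sz : S z by case: zz => ->.
  have [nu sepz] := sep_all z Sz.
  have := separated_density openU eps_gt0 eps_le s0 sepz.
  by have -> : pi / 4 * (s / 4) ^+ 2 = pi / 64 * s ^+ 2 by field.
Qed.

End LowerBound.

Theorem theorem1p2 (R : realType) :
  exists gamma0 : R, 0 < gamma0 /\
    forall Sigma : set 'rV[R]_3, lipschitz_surface Sigma ->
      (gamma0%:E <= integral_menger 8 Sigma)%E.
Proof.
have [eps [eps0 eps_le]] : exists eps : R, 0 < eps /\ 1000 * eps <= 1.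
  by exists (1 / 1000); split; lra.
exists ((eps ^+ 4 / 2000) ^+ 8 / 2 * (pi / 64 * (eps ^+ 4 / 100) ^+ 2) ^+ 4); split.
  have k0 : 0 < eps ^+ 4 by rewrite exprn_gt0.
  have k2 : 0 < eps ^+ 4 / 2000 := divr_gt0 k0 (ltr0Sn R 1999).
  have k3 : 0 < eps ^+ 4 / 100 := divr_gt0 k0 (ltr0Sn R 99).
  move: (eps ^+ 4 / 2000) (eps ^+ 4 / 100) k2 k3 => K a K0 a0.
  by rewrite mulr_gt0 ?exprn_gt0 ?divr_gt0 ?mulr_gt0 ?exprn_gt0 ?divr_gt0 ?pi_gt0.
move=> Sigma [cS coS [U dU SU] lS]; move: cS coS lS; rewrite SU => cS coS lS.
by have [_ oU _ _] := dU; exact: menger_lower_bound.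
Qed.
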